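(* If Hilbert's Tenth Problem over $\mathbb{Q}(i)$ is undecidable, then the decision problem $\Pi_{(X^2+1)^2}$ is undecidable.
   Context: An order is a commutative ring $A$ (with $1$) whose underlying additive group is isomorphic to $\mathbb{Z}^n$ for some $n \in \mathbb{Z}_{\geq 0}$. For $f \in \mathbb{Z}[X]$, $Z_A(f)$ denotes the set of zeroes of $f$ in $A$. An order is specified as input by the integer $n$ and structure constants $(a_{ijk})_{1 \le i,j,k \le n} \in \mathbb{Z}^{n^3}$ describing the multiplication on $\mathbb{Z}^n$ by $e_i \cdot e_j = \sum_{k=1}^n a_{ijk} e_k$. For a fixed $f \in \mathbb{Z}[X]$, the decision problem $\Pi_f$ is: given as input an order $A$, determine whether $Z_A(f)$ is non-empty. (The polynomial $f$ is not part of the input.) Hilbert's Tenth Problem over $\mathbb{Q}(i)$ (where $i^2=-1$) is the decision problem: given $n \in \mathbb{Z}_{\geq 1}$ and a finite set $P$ of polynomials in $\mathbb{Q}(i)[X_1,\ldots,X_n]$, determine whether the polynomials in $P$ have a common zero in $\mathbb{Q}(i)^n$. *)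

(* Defs.v *)
From HB Require Import structures.
From mathcomp Require Import all_boot all_order all_algebra.
From mathcomp Require Import complex mpoly.

Set Implicit Arguments.
Unset Strict Implicit.
Unset Printing Implicit Defensive.

Import GRing.Theory.

Local Open Scope nat_scope.

(* Codes of Kleene's mu-recursive functions.  Arities are not tracked by the
   type: missing arguments make a function undefined, and superfluous ones are
   ignored. *)
Inductive recfun : Type :=
| RZero
| RSucc
| RProj of nat
| RComp of recfun & seq recfun
| RPrec of recfun & recfun
| RMu of recfun.

(* [reval c v y]: the function with code [c] is defined at the arguments [v]
   and has value [y] there.  In primitive recursion and minimization the
   recursion (resp. search) variable is the first argument; the step function
   of a primitive recursion receives the counter, then the previous value. *)
Inductive reval : recfun -> seq nat -> nat -> Prop :=
| reval_zero v : reval RZero v 0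
| reval_succ x v : reval RSucc (x :: v) x.+1
| reval_proj i v : i < size v -> reval (RProj i) v (nth 0 v i)
| reval_comp f gs v w y :
    size w = size gs ->
    (forall i, i < size gs -> reval (nth RZero gs i) v (nth 0 w i)) ->
    reval f w y ->
    reval (RComp f gs) v y
| reval_prec0 f g v y : reval f v y -> reval (RPrec f g) (0 :: v) y
| reval_precS f g n v r y :
    reval (RPrec f g) (n :: v) r ->
    reval g [:: n, r & v] y ->
    reval (RPrec f g) (n.+1 :: v) y
| reval_mu f v n (r : nat -> nat) :
    (forall m, m < n -> reval f (m :: v) (r m).+1) ->
    reval f (n :: v) 0 ->
    reval (RMu f) v n.

(* The decision problem "given x : I, does [yes x] hold?", where the algorithm
   only has access to the Goedel number [enc x].  It must halt with output 1
   (yes) or 0 (no) on the number of every instance; nothing is required on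
   numbers that encode no instance. *)
Definition decidable_problem (I : Type) (enc : I -> nat) (yes : I -> Prop) :
  Prop :=
  exists c : recfun, forall x : I,
    exists b : bool, reval c [:: enc x] b /\ (b <-> yes x).

Definition undecidable_problem (I : Type) (enc : I -> nat)
  (yes : I -> Prop) : Prop := ~ decidable_problem enc yes.

(* All encodings rest on the bijection [CodeSeq.code : seq nat -> nat]. *)
Definition enc_seq (T : Type) (enc : T -> nat) (s : seq T) : nat :=
  CodeSeq.code (map enc s).

Definition enc_int (z : int) : nat :=
  match z with Posz k => k.*2 | Negz k => k.*2.+1 end.

Definition enc_rat (q : rat) : nat := enc_seq enc_int [:: numq q; denq q].

Definition enc_Qi (z : rat[i]) : nat := enc_seq enc_rat [:: Re z; Im z].

Local Open Scope ring_scope.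

(* [e] is a Z-basis of A, i.e. it induces an isomorphism of additive groups
   from Z^n to A. *)
Definition is_Zbasis (A : comPzRingType) (n : nat) (e : 'I_n -> A) : Prop :=
  bijective (fun u : {ffun 'I_n -> int} => \sum_(i < n) e i *~ u i).

(* An order together with the structure constants specifying it.  The rank may
   be 0, whence comPzRingType, which includes the zero ring. *)
Record order_input : Type := OrderInput {
  order_rank : nat;
  order_const : 'I_order_rank -> 'I_order_rank -> 'I_order_rank -> int;
  order_ring : comPzRingType;
  order_basis : 'I_order_rank -> order_ring;
  order_basisP : is_Zbasis order_basis;
  order_constP : forall i j,
    order_basis i * order_basis j
      = \sum_(k < order_rank) order_basis k *~ order_const i j k
}.

(* Only the rank and the structure constants are visible to the algorithm. *)
Definition enc_order (x : order_input) : nat :=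
  let I := enum 'I_(order_rank x) in
  CodeSeq.code [:: order_rank x;
    enc_seq (fun i => enc_seq (fun j => enc_seq (fun k =>
      enc_int (order_const i j k)) I) I) I].

(* Evaluation of an integer polynomial; [horner] does not apply to the zero
   ring. *)
Definition eval_int_poly (A : comPzRingType) (f : {poly int}) (x : A) : A :=
  \sum_(k < size f) x ^+ k *~ f`_k.

Definition has_zero (f : {poly int}) (A : comPzRingType) : Prop :=
  exists x : A, eval_int_poly f x = 0.

Definition Pi_undecidable (f : {poly int}) : Prop :=
  undecidable_problem enc_order (fun x => has_zero f (order_ring x)).

(* A polynomial over Q(i) is given as a list of terms: a coefficient and an
   exponent vector.  The list is unordered and may contain repetitions or zero
   coefficients, so a polynomial has several presentations. *)
Definition term (n : nat) : Type := (rat[i] * 'X_{1..n})%type.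

Definition poly_of_terms (n : nat) (s : seq (term n)) : {mpoly rat[i][n]} :=
  \sum_(t <- s) t.1 *: 'X_[t.2].

Definition enc_term (n : nat) (t : term n) : nat :=
  CodeSeq.code [:: enc_Qi t.1; CodeSeq.code t.2].

Record HTP_input : Type := HTPInput {
  HTP_nvars : nat;
  HTP_nvars_gt0 : (0 < HTP_nvars)%N;
  HTP_system : seq (seq (term HTP_nvars))
}.

Definition enc_HTP (x : HTP_input) : nat :=
  CodeSeq.code [:: HTP_nvars x; enc_seq (enc_seq (@enc_term _)) (HTP_system x)].

Definition HTP_polys (x : HTP_input) : seq {mpoly rat[i][HTP_nvars x]} :=
  [seq poly_of_terms s | s <- HTP_system x].

Definition has_common_zero (n : nat) (P : seq {mpoly rat[i][n]}) : Prop :=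
  exists v : 'I_n -> rat[i], forall p, p \in P -> p.@[v] = 0.

Definition HTP_Qi_undecidable : Prop :=
  undecidable_problem enc_HTP (fun x => has_common_zero (HTP_polys x)).

(* Main.v *)
From HB Require Import structures.
Require Import Defs.
From mathcomp Require Import all_boot all_order all_algebra.
From mathcomp Require Import complex mpoly.
From mathcomp Require Import ring zify.
Set Implicit Arguments.
Unset Strict Implicit.
Unset Printing Implicit Defensive.
Import GRing.Theory Num.Theory.

(** If y is a zero of (X^2+1)^2 in a commutative ring, then y^2 + 1 has square
    zero, and this is a quadratic condition on the nilpotent part of y.  Let
    K = Q(i) and let B = K + V + W with V = W = K^m, where the product of two
    vectors of V is the vector of W given by the polar forms of m quadratic
    forms on V, and where W is killed by V and by W.  For y = a + v + w in B the equation
    (y^2+1)^2 = 0 says that a^2 = -1 and that all m forms vanish at v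
    ([two_step_zero]).  If the forms have Gaussian integer coefficients, then 1,
    i + e_0, 2Z[i]^m inside V and Z[i]^m inside W span an order.  It does not
    contain i: its elements over i are those with v in e_0 + 2Z[i]^m.  Hence the
    order has a zero of (X^2+1)^2 exactly when the forms have a common zero
    whose first coordinate is 1 modulo 2Z[i] and whose other coordinates are in
    2Z[i] ([quadratic_order]).

    It remains to encode a system of polynomials over Q(i) in such forms.  With
    one unknown for every intermediate value, the evaluation of the polynomials
    becomes a list of quadratic equations, which is made homogeneous by an
    unknown Z; a solution with Z <> 0 then is the same as a common zero, and
    clearing denominators makes it integral.  The congruence conditions must
    leave room for every even Z, while they only control the first coordinate
    T.  The extra equation

      Z W = U^2 + U T + 2 T^2

    serves both purposes.  The right hand side has discriminant -7 T^2 and -7 is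
    not a square in Q(i), so Z <> 0 as soon as T <> 0
    ([two_adic_form_anisotropic]).  On the other hand X^2 + X + 2 has a 2-adic
    root, so for T odd the right hand side is divisible by any given power of 2
    for a suitable U ([dyadic_root]), and every nonzero even integer occurs as Z
    for some odd T.

    The reduction has to be carried out by a mu-recursive function on codes.
    For this the unknowns are indexed by codes: for every number c up to the
    code e of the instance there is an unknown for the value of the monomial
    whose exponent list has code c, and one for the value of the polynomial
    whose list of terms has code c.  These values satisfy recursions in c, one
    equation each, that do not depend on the instance ([monomial_tableE],
    [poly_tableE]); only the last family of equations, which makes the given
    polynomials vanish, reads the instance.  The structure constants thus are an
    explicit arithmetical expression in e and three indices, with one bounded
    sum ([structure_constants_computable]). *)

Local Notation code := CodeSeq.code.
Local Notation decode := CodeSeq.decode.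

(** * Computable functions of several arguments *)

(** The type T is the set of instances on which the algorithm must be correct
    and [ctx] lists the arguments it sees.  A product type T gives a function of
    several variables, whose projections play the role of variable names. *)
Definition computable (T : Type) (ctx : T -> seq nat) (F : T -> nat) : Prop :=
  exists c, forall x, reval c (ctx x) (F x).

Lemma computable_ext T (ctx : T -> seq nat) F G :
  F =1 G -> computable ctx F -> computable ctx G.
Proof. by move=> eqFG [c cP]; exists c => x; rewrite -eqFG. Qed.

Lemma computable_var i T (ctx : T -> seq nat) :
  (forall x, i < size (ctx x)) -> computable ctx (fun x => nth 0 (ctx x) i).
Proof. by move=> lti; exists (RProj i) => x; apply: reval_proj. Qed.

Fixpoint all_computable (T : Type) (ctx : T -> seq nat) (Gs : seq (T -> nat)) :=
  if Gs is G :: Gs' then computable ctx G /\ all_computable ctx Gs' else True.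

Lemma all_computable_codes T (ctx : T -> seq nat) Gs :
  all_computable ctx Gs ->
  exists2 gs, size gs = size Gs & forall x i, i < size gs ->
    reval (nth RZero gs i) (ctx x) (nth 0 [seq G x | G <- Gs] i).
Proof.
elim: Gs => [|G Gs IH] /=; first by exists [::].
case=> [[c cP] /IH [gs szgs gsP]]; exists (c :: gs); rewrite /= ?szgs //.
by move=> x [|i] //=; rewrite ltnS -szgs; apply: gsP.
Qed.

Lemma computable_comp T T' (ctx : T -> seq nat) (ctx' : T' -> seq nat)
    (F : T' -> nat) (h : T -> T') (Gs : seq (T -> nat)) :
    (forall x, ctx' (h x) = [seq G x | G <- Gs]) ->
  computable ctx' F -> all_computable ctx Gs ->
  computable ctx (fun x => F (h x)).
Proof.
move=> hE [c cP] /all_computable_codes[gs szgs gsP].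
exists (RComp c gs) => x; apply: (@reval_comp _ _ _ (ctx' (h x))).
- by rewrite hE size_map szgs.
- by move=> i /(gsP x); rewrite hE.
- exact: cP.
Qed.

Local Notation ctx1 := (fun x : nat => [:: x]).
Local Notation ctx2 := (fun p : nat * nat => [:: p.1; p.2]).

Lemma computable_app1 T (ctx : T -> seq nat) (f : nat -> nat) F :
  computable ctx1 f -> computable ctx F -> computable ctx (fun x => f (F x)).
Proof.
by move=> cf cF; apply: (computable_comp (h := F) (Gs := [:: F]) _ cf) => //=.
Qed.

Lemma computable_app2 T (ctx : T -> seq nat) (f : nat -> nat -> nat) F G :
  computable ctx2 (fun p => f p.1 p.2) ->
  computable ctx F -> computable ctx G -> computable ctx (fun x => f (F x) (G x)).
Proof.
move=> cf cF cG.
by apply: (computable_comp (h := fun x => (F x, G x)) (Gs := [:: F; G]) _ cf).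
Qed.

Lemma computable_succ T (ctx : T -> seq nat) F :
  computable ctx F -> computable ctx (fun x => (F x).+1).
Proof. by apply: computable_app1; exists RSucc => x; apply: reval_succ. Qed.

Lemma computable_const n T (ctx : T -> seq nat) : computable ctx (fun=> n).
Proof.
elim: n => [|n IHn]; last exact: computable_succ IHn.
by exists RZero => x; apply: reval_zero.
Qed.

Local Notation ctx_cons ctx := (fun p => p.1 :: ctx p.2).

Lemma reval_projs k m v i : size (drop k v) = m -> i < m ->
  reval (nth RZero [seq RProj j | j <- iota k m] i) v (nth 0 (drop k v) i).
Proof.
move=> szv ltim; rewrite (nth_map 0) ?size_iota // nth_iota // nth_drop.
by apply: reval_proj; move: szv; rewrite size_drop; lia.
Qed.

Lemma computable_skip k m T T' (ctx : T -> seq nat) (ctx' : T' -> seq nat)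
    (h : T' -> T) F :
    (forall x, size (ctx x) = m) -> (forall p, drop k (ctx' p) = ctx (h p)) ->
  computable ctx F -> computable ctx' (fun p => F (h p)).
Proof.
move=> szctx hE [c cP]; exists (RComp c (map RProj (iota k m))) => p.
apply: (@reval_comp _ _ _ (ctx (h p))); last exact: cP.
- by rewrite szctx size_map size_iota.
- move=> i; rewrite size_map size_iota -hE => ltim.
  by apply: reval_projs; rewrite ?hE.
Qed.

(** Evaluation of a function under binders: in the context of the step function
    of a recursion, two entries precede the original variables ([k] = 2). *)
Lemma computable_subst k m T T' (ctx : T -> seq nat) (ctx' : T' -> seq nat)
    (h : T' -> T) (F : T -> nat -> nat) G :
    (forall x, size (ctx x) = m) -> (forall p, drop k (ctx' p) = ctx (h p)) ->
    computable ctx' G ->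
  computable (ctx_cons ctx) (fun p => F p.2 p.1) ->
  computable ctx' (fun p => F (h p) (G p)).
Proof.
move=> szctx hE [g gP] [c cP]; exists (RComp c (g :: map RProj (iota k m))) => p.
apply: (@reval_comp _ _ _ (G p :: ctx (h p))); last exact: (cP (_, _)).
- by rewrite /= szctx size_map size_iota.
- move=> [|i] /=; first by move=> _; apply: gP.
  rewrite ltnS size_map size_iota -hE => ltim.
  by apply: reval_projs; rewrite ?hE.
Qed.

Lemma computable_iteri m T (ctx : T -> seq nat) (s : T -> nat)
    (g : T -> nat -> nat -> nat) (n : T -> nat) :
    (forall x, size (ctx x) = m) ->
  computable ctx s ->
  computable (ctx_cons (ctx_cons ctx)) (fun p => g p.2.2 p.1 p.2.1) ->
  computable ctx n -> computable ctx (fun x => iteri (n x) (g x) (s x)).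
Proof.
move=> szctx [cs csP] [cg cgP] [cn cnP].
exists (RComp (RPrec cs cg) (cn :: map RProj (iota 0 m))) => x.
apply: (@reval_comp _ _ _ (n x :: ctx x)).
- by rewrite /= size_map size_iota szctx.
- move=> [|i] /=; first by move=> _; apply: cnP.
  rewrite ltnS size_map size_iota => ltim.
  by have := @reval_projs 0 m (ctx x) i; rewrite drop0; apply.
- elim: (n x) => [|k IHk]; first exact/reval_prec0/csP.
  exact: reval_precS IHk (cgP (k, (_, x))).
Qed.

(* A projection of the instance is convertible to an entry of its context; the
   position of this entry is found by trial. *)
Ltac comp_var_at i :=
  refine (@computable_var i _ _ _); exact (fun _ => isT).
Ltac comp_var := first
  [ comp_var_at 0 | comp_var_at 1 | comp_var_at 2
  | comp_var_at 3 | comp_var_at 4 | comp_var_at 5 ].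

Lemma computable_pred T (ctx : T -> seq nat) F :
  computable ctx F -> computable ctx (fun x => (F x).-1).
Proof.
apply: computable_app1.
apply: (@computable_ext _ _ (fun n => iteri n (fun k _ => k) 0)); first by case.
apply: (computable_iteri (m := 1)) => //; [exact: computable_const | | ]; comp_var.
Qed.

Lemma computable_add T (ctx : T -> seq nat) F G :
  computable ctx F -> computable ctx G -> computable ctx (fun x => F x + G x).
Proof.
apply: computable_app2.
apply: (@computable_ext _ _ (fun p => iteri p.1 (fun _ r => r.+1) p.2)).
  by case=> m n /=; elim: m => //= m ->.
apply: (computable_iteri (m := 2)) => //; [comp_var | | comp_var].
apply: computable_succ; comp_var.
Qed.

Lemma computable_mul T (ctx : T -> seq nat) F G :
  computable ctx F -> computable ctx G -> computable ctx (fun x => F x * G x).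
Proof.
apply: computable_app2.
apply: (@computable_ext _ _ (fun p => iteri p.1 (fun _ r => p.2 + r) 0)).
  by case=> m n /=; elim: m => //= m ->; rewrite mulSn.
apply: (computable_iteri (m := 2)) => //; [exact: computable_const | | comp_var].
apply: computable_add; comp_var.
Qed.

Lemma computable_sub T (ctx : T -> seq nat) F G :
  computable ctx F -> computable ctx G -> computable ctx (fun x => F x - G x).
Proof.
apply: computable_app2.
apply: (@computable_ext _ _ (fun p => iteri p.2 (fun _ r => r.-1) p.1)).
  by case=> m n /=; elim: n => [|n /= ->]; rewrite ?subn0 // subnS.
apply: (computable_iteri (m := 2)) => //; [comp_var | | comp_var].
apply: computable_pred; comp_var.
Qed.

Lemma computable_double T (ctx : T -> seq nat) F :
  computable ctx F -> computable ctx (fun x => (F x).*2).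
Proof.
move=> cF; apply: (@computable_ext _ _ (fun x => F x + F x)) => [x|].
  by rewrite addnn.
exact: computable_add.
Qed.

Lemma computable_leq T (ctx : T -> seq nat) F G :
  computable ctx F -> computable ctx G ->
  computable ctx (fun x => nat_of_bool (F x <= G x)).
Proof.
move=> cF cG; apply: (@computable_ext _ _ (fun x => 1 - (F x - G x))) => [x|].
  by rewrite /leq; case: (F x - G x).
by apply: computable_sub; [exact: computable_const | exact: computable_sub].
Qed.

Lemma computable_and T (ctx : T -> seq nat) (P Q : T -> bool) :
  computable ctx P -> computable ctx Q ->
  computable ctx (fun x => nat_of_bool (P x && Q x)).
Proof.
move=> cP cQ; apply: (@computable_ext _ _ (fun x => P x * Q x)) => [x|].
  by rewrite mulnb.
exact: computable_mul.
Qed.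

Lemma computable_eq T (ctx : T -> seq nat) F G :
  computable ctx F -> computable ctx G ->
  computable ctx (fun x => nat_of_bool (F x == G x)).
Proof.
move=> cF cG.
apply: (@computable_ext _ _ (fun x => nat_of_bool ((F x <= G x) && (G x <= F x)))).
  by move=> x; rewrite eqn_leq.
by apply: computable_and; apply: computable_leq.
Qed.

Lemma computable_if T (ctx : T -> seq nat) (P : T -> bool) F G :
  computable ctx P -> computable ctx F -> computable ctx G ->
  computable ctx (fun x => if P x then F x else G x).
Proof.
move=> cP cF cG.
apply: (@computable_ext _ _ (fun x => P x * F x + (1 - P x) * G x)) => [x|].
  by case: (P x); rewrite /= !(mul0n, mul1n, addn0, add0n).
apply: computable_add; apply: computable_mul => //.
by apply: computable_sub => //; apply: computable_const.
Qed.

Lemma computable_odd T (ctx : T -> seq nat) F :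
  computable ctx F -> computable ctx (fun x => nat_of_bool (odd (F x))).
Proof.
move=> cF; apply: (computable_app1 (f := fun n => nat_of_bool (odd n)) _ cF).
apply: (@computable_ext _ _ (fun n => iteri n (fun _ r => 1 - r) 0)).
  by elim=> //= n ->; case: (odd n).
apply: (computable_iteri (m := 1)) => //; [exact: computable_const | | comp_var].
by apply: computable_sub; [exact: computable_const | comp_var].
Qed.

Lemma computable_half T (ctx : T -> seq nat) F :
  computable ctx F -> computable ctx (fun x => (F x)./2).
Proof.
apply: computable_app1.
apply: (@computable_ext _ _ (fun n => iteri n (fun k r => odd k + r) 0)).
  by elim=> //= n ->; rewrite uphalf_half.
apply: (computable_iteri (m := 1)) => //; [exact: computable_const | | comp_var].
by apply: computable_add; [apply: computable_odd; comp_var | comp_var].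
Qed.

Lemma computable_exp2 T (ctx : T -> seq nat) F :
  computable ctx F -> computable ctx (fun x => 2 ^ F x).
Proof.
apply: computable_app1.
apply: (@computable_ext _ _ (fun n => iteri n (fun _ r => r.*2) 1)).
  by elim=> //= n ->; rewrite expnS mul2n.
apply: (computable_iteri (m := 1)) => //; [exact: computable_const | | comp_var].
by apply: computable_double; comp_var.
Qed.

Lemma computable_sum m T (ctx : T -> seq nat) (F : T -> nat -> nat) n :
    (forall x, size (ctx x) = m) ->
  computable (ctx_cons ctx) (fun p => F p.2 p.1) -> computable ctx n ->
  computable ctx (fun x => \sum_(i < n x) F x i).
Proof.
move=> szctx cF cn.
apply: (@computable_ext _ _ (fun x => iteri (n x) (fun k r => F x k + r) 0)).
  by move=> x; elim: (n x) => [|k /= ->]; rewrite ?big_ord0 // big_ord_recr addnC.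
apply: (computable_iteri szctx) => //; first exact: computable_const.
apply: computable_add; last comp_var_at 1.
apply: (computable_subst (k := 2) (h := fun p => p.2.2) szctx _ _ cF) => [p|].
  exact: drop0.
comp_var_at 0.
Qed.

(** * Computing with codes of lists *)

(** The code of n :: s is 2 ^ n * (2 * code s + 1).  Halving as long as the number
    is even reaches 2 * code s + 1 after n steps; the number itself bounds the
    number of steps. *)
Definition code_tail_step s := if odd s then s else s./2.
Definition code_head s := \sum_(k < s) ~~ odd (iter k code_tail_step s).
Definition code_tail s := (iter s code_tail_step s)./2.

Lemma iter_code_tail_step k n m :
  iter k code_tail_step (2 ^ n * m.*2.+1) = 2 ^ (n - k) * m.*2.+1.
Proof.
elim: k => [|k IHk]; rewrite ?subn0 //= IHk /code_tail_step subnS.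
case: (n - k) => [|j]; first by rewrite mul1n /= odd_double.
by rewrite expnS -mulnA mul2n odd_double doubleK.
Qed.

Lemma leq_pow_code n m : n <= 2 ^ n * m.*2.+1.
Proof. by apply: leq_trans (ltnW (ltn_expl n (isT : 1 < 2))) _; apply: leq_pmulr. Qed.

Lemma code_head_pow n m : code_head (2 ^ n * m.*2.+1) = n.
Proof.
rewrite /code_head; under eq_bigr => k _ do
  rewrite iter_code_tail_step oddM oddX /= odd_double andbT orbF subn_eq0 -ltnNge.
have len := leq_pow_code n m.
rewrite -(big_mkord predT (fun k => nat_of_bool (k < n))) (big_cat_nat (n := n)) //=.
rewrite (eq_big_nat _ _ (F2 := fun=> 1)); last by move=> k /andP[_ ->].
rewrite sum_nat_const_nat subn0 muln1 big_nat_cond big1 ?addn0 // => k.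
by rewrite andbT => /andP[lenk _]; rewrite ltnNge lenk.
Qed.

Lemma code_tail_pow n m : code_tail (2 ^ n * m.*2.+1) = m.
Proof.
rewrite /code_tail iter_code_tail_step.
have /eqP-> : n - 2 ^ n * m.*2.+1 == 0.
  by rewrite subn_eq0 leq_pow_code.
by rewrite mul1n /= uphalf_double.
Qed.

Lemma code_head_cons n s : code_head (code (n :: s)) = n.
Proof. exact: code_head_pow. Qed.

Lemma code_tail_cons n s : code_tail (code (n :: s)) = code s.
Proof. exact: code_tail_pow. Qed.

Lemma code_head0 : code_head 0 = 0. Proof. by rewrite /code_head big_ord0. Qed.
Lemma code_tail0 : code_tail 0 = 0. Proof. by []. Qed.

Lemma codeP s : s = 0 \/ s = 2 ^ code_head s * (code_tail s).*2.+1.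
Proof.
rewrite -[s]CodeSeq.decodeK; case: (decode s) => [|n l]; [by left | right].
by rewrite code_head_cons code_tail_cons.
Qed.

Lemma code_head_leq s : code_head s <= s.
Proof.
case: (codeP s) => [->|sE]; first by rewrite code_head0.
by rewrite {2}sE leq_pow_code.
Qed.

Lemma code_tail_leq s : code_tail s <= s.
Proof.
case: (codeP s) => [->//|sE]; rewrite {2}sE.
by apply: leq_trans (leq_pmull _ _); rewrite ?expn_gt0 //; lia.
Qed.

Lemma computable_code_tail_iter T (ctx : T -> seq nat) F G :
  computable ctx F -> computable ctx G ->
  computable ctx (fun x => iter (F x) code_tail_step (G x)).
Proof.
move=> cF cG; apply: (computable_app2 (f := fun k => iter k code_tail_step) _ cF cG).
apply: (@computable_ext _ _
  (fun p => iteri p.1 (fun _ r => if odd r then r else r./2) p.2)).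
  by case=> m n /=; elim: m => //= m ->.
apply: (computable_iteri (m := 2)) => //; try comp_var.
by apply: computable_if; [apply: computable_odd | | apply: computable_half]; comp_var.
Qed.

Lemma computable_code_head T (ctx : T -> seq nat) F :
  computable ctx F -> computable ctx (fun x => code_head (F x)).
Proof.
apply: computable_app1.
apply: (computable_sum (m := 1) (n := id)
  (F := fun s k => nat_of_bool (~~ odd (iter k code_tail_step s)))) => //;
  last by comp_var.
apply: (@computable_ext _ _ (fun p => 1 - odd (iter p.1 code_tail_step p.2))).
  by move=> x /=; case: odd.
apply: computable_sub; first exact: computable_const.
by apply: computable_odd; apply: computable_code_tail_iter; comp_var.
Qed.

Lemma computable_code_tail T (ctx : T -> seq nat) F :
  computable ctx F -> computable ctx (fun x => code_tail (F x)).
Proof.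
apply: computable_app1; apply: computable_half.
by apply: computable_code_tail_iter; comp_var.
Qed.

Definition code_nth s l := code_head (iter l code_tail s).

Lemma code_nth_code l s : code_nth (code s) l = nth 0 s l.
Proof.
rewrite /code_nth; have -> : iter l code_tail (code s) = code (drop l s).
  elim: l s => [|l IHl] s; first by rewrite drop0.
  by rewrite iterSr; case: s => [|n s]; [exact: (IHl [::]) | rewrite code_tail_cons].
by elim: l s => [|l IHl] [|n s];
  [exact: code_head0 | exact: code_head_cons | exact: code_head0 | exact: IHl].
Qed.

Lemma code_nth_leq s l : (code_nth s l <= s).
Proof.
apply: leq_trans (code_head_leq _) _; elim: l => //= l IHl.
exact: leq_trans (code_tail_leq _) IHl.
Qed.

Lemma size_code_leq s : size s <= code s.
Proof.
elim: s => // n s IHs; apply: leq_ltn_trans IHs _.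
rewrite -[code (n :: s)]/(2 ^ n * (code s).*2.+1).
by apply: leq_trans (leq_pmull _ _); rewrite ?expn_gt0 //; lia.
Qed.

Lemma computable_code_nth T (ctx : T -> seq nat) F G :
  computable ctx F -> computable ctx G -> computable ctx (fun x => code_nth (F x) (G x)).
Proof.
move=> cF cG; apply: (computable_app2 (f := code_nth) _ cF cG).
apply: computable_code_head.
apply: (@computable_ext _ _ (fun p => iteri p.2 (fun _ r => code_tail r) p.1)).
  by case=> m n /=; elim: n => //= n ->.
apply: (computable_iteri (m := 2)) => //; try comp_var.
by apply: computable_code_tail; comp_var.
Qed.

(** A code is built from the last entry to the first, so the recursion counts
    positions backwards. *)
Lemma computable_mkseq m T (ctx : T -> seq nat) (F : T -> nat -> nat) n :
    (forall x, size (ctx x) = m) ->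
  computable (ctx_cons ctx) (fun p => F p.2 p.1) -> computable ctx n ->
  computable ctx (fun x => code (mkseq (F x) (n x))).
Proof.
move=> szctx cF cn.
pose g x k r := 2 ^ F x ((n x).-1 - k) * r.*2.+1.
apply: (@computable_ext _ _ (fun x => iteri (n x) (g x) 0)) => [x|].
  suff itE : forall k, k <= n x ->
      iteri k (g x) 0 = code [seq F x i | i <- iota (n x - k) k].
    by rewrite itE // subnn.
  elim=> // k IHk ltkn; rewrite /= IHk ?(ltnW ltkn) // /g.
  have -> : n x - k = (n x - k.+1).+1 by rewrite subnSK.
  by have -> : (n x).-1 - k = n x - k.+1 by rewrite -subn1 -subnDA.
apply: (computable_iteri szctx) => //; first exact: computable_const.
rewrite /g; apply: computable_mul; last first.
  apply/computable_succ/computable_double; comp_var_at 1.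
apply: computable_exp2.
apply: (computable_subst (k := 2) (h := fun p => p.2.2) szctx _ _ cF) => [p|].
  exact: drop0.
apply: computable_sub; last comp_var_at 0.
apply/computable_pred/(computable_skip (k := 2) (h := fun p => p.2.2) szctx _ cn).
by move=> p; exact: drop0.
Qed.

Local Open Scope ring_scope.

(** * Orders from embeddings *)

Lemma rmorph_eval_int_poly (A B : comPzRingType) (phi : {rmorphism A -> B})
    (f : {poly int}) (x : A) :
  phi (eval_int_poly f x) = eval_int_poly f (phi x).
Proof.
by rewrite rmorph_sum; apply: eq_bigr => k _; rewrite rmorphMz rmorphXn.
Qed.

(** An alias of the type of finite functions, free of their pointwise product:
    it is to carry the product defined by structure constants. *)
Definition int_vectors (n : nat) : Type := {ffun 'I_n -> int}.
HB.instance Definition _ n := GRing.Zmodule.on (int_vectors n).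

Definition unit_vector n (s : 'I_n) : int_vectors n := [ffun t => (s == t)%:R].

Lemma int_vectorsE n (x : int_vectors n) :
  x = \sum_(s < n) unit_vector s *~ x s.
Proof.
apply/ffunP => t; rewrite sum_ffunE (bigD1 t) //= big1 => [|s nst].
  by rewrite ffunMzE ffunE eqxx addr0 intz.
by rewrite ffunMzE ffunE (negPf nst) mul0rz.
Qed.

Section OrderOfEmbedding.
Variables (n : nat) (c : 'I_n -> 'I_n -> 'I_n -> int) (B : comPzRingType).
Variables (Phi : {additive int_vectors n -> B}) (one : int_vectors n).
Hypotheses (Phi_inj : injective Phi) (Phi1 : Phi one = 1).
Hypothesis PhiM : forall s t, Phi (unit_vector s) * Phi (unit_vector t)
  = Phi [ffun u => c s t u].

Let mul (x y : int_vectors n) : int_vectors n :=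
  \sum_s \sum_t ([ffun u => c s t u] : int_vectors n) *~ (x s * y t).

Let Phi_mul x y : Phi (mul x y) = Phi x * Phi y.
Proof.
rewrite [in RHS](int_vectorsE x) [in RHS](int_vectorsE y) !raddf_sum mulr_suml.
apply: eq_bigr => s _; rewrite raddf_sum mulr_sumr; apply: eq_bigr => t _.
rewrite !raddfMz -PhiM mulrzAl mulrzAr [x s * y t]mulrC.
by rewrite [LHS]mulrzA.
Qed.

(** The ring axioms need not be checked on the structure constants: the product
    that they define on Z^n is transported from a known ring by an injective
    additive map. *)
Lemma order_of_embedding :
  exists (A : comPzRingType) (e : 'I_n -> A),
    [/\ is_Zbasis e,
        forall i j, e i * e j = \sum_(k < n) e k *~ c i j k &
        forall f, has_zero f A <-> exists u, eval_int_poly f (Phi u) = 0].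
Proof.
have mulA : associative mul.
  by move=> x y z; apply: Phi_inj; rewrite !Phi_mul mulrA.
have mulC : commutative mul.
  by move=> x y; apply: Phi_inj; rewrite !Phi_mul mulrC.
have mul1 : left_id one mul.
  by move=> x; apply: Phi_inj; rewrite !Phi_mul Phi1 mul1r.
have mulD : left_distributive mul +%R.
  by move=> x y z; apply: Phi_inj; rewrite raddfD /= !Phi_mul raddfD mulrDl.
pose A : comPzRingType := HB.pack (int_vectors n)
  (GRing.Zmodule_isComPzRing.Build (int_vectors n) mulA mulC mul1 mulD).
have phiD : additive (Phi : A -> B) by exact: raddfB.
have phiM : monoid_morphism (Phi : A -> B) by split; [exact: Phi1 | exact: Phi_mul].
pose phi : {rmorphism A -> B} := HB.pack (Phi : A -> B)
  (GRing.isZmodMorphism.Build A B (Phi : A -> B) phiD)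
  (GRing.isMonoidMorphism.Build A B (Phi : A -> B) phiM).
exists A, (@unit_vector n); split.
- exists (id : A -> {ffun 'I_n -> int}) => u; exact: esym (int_vectorsE u).
- move=> i j; apply: Phi_inj; rewrite [LHS]Phi_mul PhiM; congr (Phi _).
  by rewrite [LHS]int_vectorsE; apply: eq_bigr => k _; rewrite ffunE.
- move=> f; split=> -[x fx0]; exists x.
    by have := rmorph_eval_int_poly phi f x; rewrite fx0 rmorph0.
  apply: Phi_inj; transitivity (eval_int_poly f (Phi x)); last by rewrite fx0 raddf0.
  exact: (rmorph_eval_int_poly phi).
Qed.
End OrderOfEmbedding.

(** * Nilpotent extensions defined by quadratic forms *)

Section TwoStep.
Variables (K : comNzRingType) (m : nat) (Q : 'I_m -> 'M[K]_m).

Definition polar (v w : 'rV[K]_m) : 'rV[K]_m :=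
  \row_k (v *m (Q k + (Q k)^T) *m w^T) 0 0.

Lemma polarC v w : polar v w = polar w v.
Proof.
apply/rowP => k; rewrite mxE [RHS]mxE; set A := Q k + _.
have symA : A^T = A by rewrite /A linearD /= trmxK addrC.
have -> : w *m A *m v^T = (v *m A *m w^T)^T by rewrite !trmx_mul trmxK symA mulmxA.
by rewrite [RHS]mxE.
Qed.

Lemma polarDl v v' w : polar (v + v') w = polar v w + polar v' w.
Proof. by apply/rowP => k; rewrite mxE !mulmxDl mxE [RHS]mxE ![polar _ _ _ _]mxE. Qed.

Lemma polarZl a v w : polar (a *: v) w = a *: polar v w.
Proof. by apply/rowP => k; rewrite mxE -!scalemxAl mxE [RHS]mxE ![polar _ _ _ _]mxE. Qed.

Lemma polarDr v w w' : polar v (w + w') = polar v w + polar v w'.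
Proof. by rewrite polarC polarDl ![polar _ v]polarC. Qed.

Lemma polarZr a v w : polar v (a *: w) = a *: polar v w.
Proof. by rewrite polarC polarZl polarC. Qed.

(** The forms [Q] are an argument because the product depends on them. *)
Definition two_step (_ : 'I_m -> 'M[K]_m) : Type := (K * 'rV[K]_m * 'rV[K]_m)%type.
HB.instance Definition _ := GRing.Zmodule.on (two_step Q).

Definition two_step_mul (x y : two_step Q) : two_step Q :=
  (x.1.1 * y.1.1, x.1.1 *: y.1.2 + y.1.1 *: x.1.2,
   x.1.1 *: y.2 + y.1.1 *: x.2 + polar x.1.2 y.1.2).

Fact two_step_mulC : commutative two_step_mul.
Proof.
move=> [[a v] w] [[a' v'] w']; rewrite /two_step_mul /= mulrC polarC.
by congr (_, _, (_ + _)); rewrite addrC.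
Qed.

Fact two_step_mulA : associative two_step_mul.
Proof.
move=> [[a v] w] [[a' v'] w'] [[a'' v''] w'']; rewrite /two_step_mul /=.
rewrite !polarDr !polarDl !polarZr !polarZl !scalerDr !scalerA mulrA.
congr (_, _, _).
  by rewrite !addrA [a'' * a]mulrC [a'' * a']mulrC.
rewrite [a'' * a]mulrC [a'' * a']mulrC -!addrA; congr (_ + (_ + _)).
by rewrite addrCA; congr (_ + _); rewrite addrA addrC.
Qed.

Fact two_step_mul1 : left_id ((1, 0, 0) : two_step Q) two_step_mul.
Proof.
move=> [[a v] w]; rewrite /two_step_mul /= mul1r !scale1r !scaler0 !addr0.
by rewrite -(scale0r 0) polarZl scale0r addr0.
Qed.

Fact two_step_mulD : left_distributive two_step_mul +%R.
Proof.
move=> [[a v] w] [[a' v'] w'] [[a'' v''] w'']; rewrite /two_step_mul /=.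
congr (_, _, _); rewrite /= ?mulrDl ?scalerDl ?scalerDr ?polarDl ?addrA //.
  by congr (_ + _); rewrite addrAC.
congr (_ + _); rewrite [LHS]addrAC; congr (_ + _).
by rewrite [RHS]addrAC; congr (_ + _); rewrite addrAC.
Qed.

HB.instance Definition _ := GRing.Zmodule_isComPzRing.Build (two_step Q)
  two_step_mulA two_step_mulC two_step_mul1 two_step_mulD.

Lemma two_step_mulE (x y : two_step Q) : x * y = two_step_mul x y.
Proof. by []. Qed.

End TwoStep.
Arguments two_step {K m} Q.

Lemma eval_X2p1_sq (A : comPzRingType) (x : A) :
  eval_int_poly (('X^2 + 1) ^+ 2) x = (x ^+ 2 + 1) ^+ 2.
Proof.
rewrite /eval_int_poly; have -> : size (('X^2 + 1 : {poly int}) ^+ 2) = 5%N.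
  have := size_exp ('X^2 + 1 : {poly int}) 2.
  by rewrite -[1]/(1%:P) size_XnaddC //; case: size => // k /= ->.
have -> : ('X^2 + 1) ^+ 2 = 'X^4 + 'X^2 *+ 2 + 1 :> {poly int}.
  by rewrite sqrrD expr1n mulr1 -exprM.
rewrite !big_ord_recr big_ord0 /= !coefD !coefXn !coef1 /=.
rewrite !(addr0, add0r) !mulr1n mulrzDr !mulr1z expr0.
by rewrite sqrrD expr1n mulr1 -exprM mulr2n -[RHS]addrA addrC [1 + _]addrC.
Qed.

(** With y = (a, v, w), the square of y^2 + 1 = (a^2 + 1, 2av, 2aw + polar v v)
    has first component (a^2 + 1)^2; once this vanishes, only the last component
    4a^2 polar v v = -4 polar v v remains. *)
Lemma two_step_zero (K : fieldType) m (Q : 'I_m -> 'M[K]_m) (x : two_step Q) :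
  2%:R != 0 :> K ->
  (x ^+ 2 + 1) ^+ 2 = 0 <-> x.1.1 ^+ 2 = -1 /\ polar Q x.1.2 x.1.2 = 0.
Proof.
move=> K2; case: x => [[a v] w] /=; rewrite !expr2 !two_step_mulE /two_step_mul /=.
rewrite !addr0 polarDr !polarDl !polarZr !polarZl -!scalerDl.
have sum4 : (a + a + (a + a)) * a = 2%:R * 2%:R * (a * a) by ring.
split=> [[aa0 _ +]|[aa P0]].
  have {}aa0 : a * a + 1 = 0 by move/eqP: aa0; rewrite mulf_eq0 orbb => /eqP.
  have aa : a * a = -1 by apply/eqP; rewrite -addr_eq0 aa0.
  rewrite aa0 addr0 scale0r add0r scalerA sum4 aa => /eqP.
  by rewrite scaler_eq0 mulrN1 oppr_eq0 mulf_eq0 (negPf K2) /= => /eqP ->.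
by rewrite P0 aa addNr !addr0 !scaler0 mul0r !scale0r addr0.
Qed.

(** * Gaussian integers in Q(i) *)

Local Notation Qi := (rat[i]).

Definition gauss (a b : int) : Qi := Complex a%:~R b%:~R.

Definition imag : Qi := gauss 0 1.

Lemma gaussD a b a' b' : gauss (a + a') (b + b') = gauss a b + gauss a' b'.
Proof. by rewrite /gauss !intrD. Qed.

Lemma gaussN a b : gauss (- a) (- b) = - gauss a b.
Proof. by rewrite /gauss !mulrNz. Qed.

Lemma gaussM a b a' b' :
  gauss (a * a' - b * b') (a * b' + b * a') = gauss a b * gauss a' b'.
Proof. by rewrite /gauss !intrD mulrNz !intrM. Qed.

Lemma gauss_int a : gauss a 0 = a%:~R.
Proof.
have gaussMn n : gauss n%:Z 0 = n%:R.
  elim: n => [|n IHn]; first by [].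
  by rewrite mulrS -IHn -[1](erefl : gauss 1 0 = 1) -gaussD addr0 -intS.
case: a => n; first exact: gaussMn.
by rewrite NegzE mulrNz -[(_%:~R : Qi)]gaussMn -gaussN oppr0.
Qed.

Lemma gaussE a b : gauss a b = a%:~R + imag * b%:~R.
Proof.
rewrite -!gauss_int -gaussM -gaussD; congr gauss; ring.
Qed.

Lemma gauss_inj a b a' b' : gauss a b = gauss a' b' -> a = a' /\ b = b'.
Proof. by case=> /intr_inj-> /intr_inj->. Qed.

Lemma gauss_eq0 a b : gauss a b = 0 -> a = 0 /\ b = 0.
Proof. by move=> ab0; apply: gauss_inj; rewrite ab0. Qed.

Lemma imag_sq : imag * imag = -1.
Proof. by rewrite -gaussM mulr0 mulr1 mulr0 sub0r addr0 gauss_int mulrN1z. Qed.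

Lemma Qi_two_neq0 : 2%:R != 0 :> Qi.
Proof. by []. Qed.

(** * The order of a system of quadratic forms *)

(** The power of i attached to a basis index: the vectors of even index 2j and
    odd index 2j + 1 are 1 and i times the same vector, except for 1 and
    i + e_0 at j = 0. *)
Definition ipow (s : nat) : Qi := if odd s then imag else 1.

Lemma gauss_sqN1 a b : gauss a b ^+ 2 = -1 -> a = 0 /\ (b = 1 \/ b = -1).
Proof.
move/eqP; rewrite -imag_sq -expr2 eqf_sqr => /orP[/eqP/gauss_inj[-> ->]|].
  by split=> //; left.
by rewrite -gaussN => /eqP/gauss_inj[-> ->]; split=> //; right.
Qed.

Section QuadraticOrder.
Variables (m : nat) (b : nat -> nat -> nat -> Qi).
Hypothesis m_gt0 : (0 < m)%N.

Let Q (k : 'I_m) : 'M[Qi]_m := \matrix_(p, q) b k p q.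

Definition quad_rank : nat := (4 * m).+2.

Definition gauss_coord (u : int_vectors quad_rank) (j : nat) : Qi :=
  gauss (u (inord j.*2)) (u (inord j.*2.+1)).

Lemma gauss_coordB u u' j :
  gauss_coord (u - u') j = gauss_coord u j - gauss_coord u' j.
Proof. by rewrite /gauss_coord !ffunE gaussD gaussN. Qed.

(** Coordinates with respect to the basis 1, i + e_0, then 2 e_p and 2 i e_p for
    the m vectors of V, then the m vectors of W and their multiples by i.  The
    summand at j = 0 is the e_0 of i + e_0. *)
Definition order_embed (u : int_vectors quad_rank) : two_step Q :=
  (gauss_coord u 0,
   \row_(j < m) ((u (inord 1))%:~R *+ (j == 0 :> nat) + 2%:R * gauss_coord u j.+1),
   \row_(k < m) gauss_coord u (m + k).+1).

Fact order_embed_is_additive : additive order_embed.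
Proof.
move=> u u'; congr (_, _, _); first exact: gauss_coordB.
  apply/rowP => j; rewrite !mxE gauss_coordB mulrBr opprD addrACA -mulrnBl.
  by rewrite !ffunE mulrzBr.
by apply/rowP => k; rewrite !mxE gauss_coordB.
Qed.
HB.instance Definition _ :=
  GRing.isZmodMorphism.Build (int_vectors quad_rank) (two_step Q) order_embed
    order_embed_is_additive.

Lemma order_embed_inj : injective order_embed.
Proof.
apply: raddf_inj => u /pair_equal_spec[/pair_equal_spec[a0 v0] w0].
have [u0 u1] : u (inord 0) = 0 /\ u (inord 1) = 0 := gauss_eq0 a0.
have coord0 j : (j <= 2 * m)%N -> gauss_coord u j = 0.
  case: j => [//|j] lejm; have [ltjm|lemj] := ltnP j m.
    have := congr1 (fun v : 'rV_m => v 0 (Ordinal ltjm)) v0.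
    rewrite !mxE u1 mulr0z mul0rn add0r => /eqP.
    by rewrite mulf_eq0 (negPf Qi_two_neq0) => /eqP.
  have ltk : (j - m < m)%N by lia.
  have := congr1 (fun v : 'rV_m => v 0 (Ordinal ltk)) w0.
  by rewrite !mxE /= subnKC.
apply/ffunP => s; rewrite ffunE.
have lts : (s./2 <= 2 * m)%N by have := ltn_ord s; rewrite /quad_rank; lia.
have [ue uo] : u (inord s./2.*2) = 0 /\ u (inord s./2.*2.+1) = 0.
  exact: gauss_eq0 (coord0 _ lts).
rewrite -[s]inord_val -[val s]odd_double_half.
by case: (odd s); rewrite ?add1n ?add0n.
Qed.

Lemma gauss_coord_unit s j : (j <= 2 * m)%N ->
  gauss_coord (unit_vector s) j = ipow s *+ (s./2 == j).
Proof.
move=> lej; rewrite /gauss_coord /ipow !ffunE -!val_eqE /= !inordK;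
  try by rewrite /quad_rank; lia.
have [<-|neq] := eqVneq s./2 j.
  have [oddE evenE] : (s == s./2.*2.+1 :> nat) = odd s /\
                      (s == s./2.*2 :> nat) = ~~ odd s by lia.
  by rewrite oddE evenE; case: (odd s).
have [-> ->] : (s == j.*2.+1 :> nat) = false /\ (s == j.*2 :> nat) = false by lia.
by [].
Qed.

(** The component in V of a basis vector is a multiple of one vector e_p, also
    for i + e_0, where p = 0, and for the basis of W, where the multiple is 0. *)
Definition basis_pos (s : nat) : nat := s./2.-1.
Definition basis_val (s : nat) : Qi :=
  if s./2 == 0 then (odd s)%:R else if (s./2 <= m)%N then 2%:R * ipow s else 0.

Lemma order_embed_unitV s j :
  (order_embed (unit_vector s)).1.2 0 j = basis_val s *+ (j == basis_pos s :> nat).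
Proof.
rewrite mxE gauss_coord_unit; last by have := ltn_ord j; lia.
rewrite ffunE -val_eqE /= inordK //; have ltj := ltn_ord j.
rewrite /basis_val /basis_pos; have [s0|s_neq0] := eqVneq s./2 0.
  rewrite s0 mulr0n mulr0 addr0; have -> : (s == 1 :> nat) = odd s by lia.
  by case: (odd s).
have -> : (s == 1 :> nat) = false by lia.
rewrite mulr0z mul0rn add0r.
have -> : (s./2 == j.+1) = (j == s./2.-1 :> nat) by lia.
by case: eqP => [jE|]; rewrite ?mulr0 //; have -> : (s./2 <= m)%N by lia.
Qed.

Lemma polar_order_embed_unit s t k :
  polar Q (order_embed (unit_vector s)).1.2 (order_embed (unit_vector t)).1.2 0 k
  = (b k (basis_pos s) (basis_pos t) + b k (basis_pos t) (basis_pos s))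
    * basis_val s * basis_val t.
Proof.
have vE r : (basis_pos r < m)%N \/ basis_val r = 0.
  rewrite /basis_pos /basis_val; case: eqP => [->|]; first by left.
  by have [lem|_] := leqP r./2 m; [left; lia | right].
have UE (r : 'I_quad_rank) (ltr : (basis_pos r < m)%N) :
    (order_embed (unit_vector r)).1.2 = basis_val r *: delta_mx 0 (Ordinal ltr).
  by apply/rowP => j; rewrite order_embed_unitV !mxE eqxx mulr_natr.
have U0 (r : 'I_quad_rank) : basis_val r = 0 -> (order_embed (unit_vector r)).1.2 = 0.
  by move=> vr0; apply/rowP => j; rewrite order_embed_unitV !mxE vr0 mul0rn.
have [lts|/[dup] /U0-> ->] := vE s; last first.
  by rewrite -(scale0r 0) polarZl scale0r mxE mulr0 mul0r.
have [ltt|/[dup] /U0-> ->] := vE t; last first.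
  by rewrite -(scale0r 0) polarZr scale0r mxE mulr0.
rewrite !UE polarZl polarZr.
have -> : polar Q (delta_mx 0 (Ordinal lts)) (delta_mx 0 (Ordinal ltt)) =
   \row_k (b k (basis_pos s) (basis_pos t) + b k (basis_pos t) (basis_pos s)).
  by apply/rowP => l; rewrite mxE -rowE trmx_delta -colE !mxE.
by rewrite !mxE; ring.
Qed.

(** The coordinates 2j and 2j + 1 of the product of two basis vectors, as one
    Gaussian integer.  The first two summands are the products with 1 and with i;
    the third comes from (i + e_0)^2 = -1 + 2 i e_0 + e_0^2; the last is the polar
    form, with values in W. *)
Definition gauss_const (s t j : nat) : Qi :=
  ipow s * ipow t *+ ((s./2 == 0) && (t./2 == j))
  + ipow s * ipow t *+ [&& t./2 == 0, s./2 == j & 0 < j]%N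
  + imag *+ [&& j == 1, s == 1 & t == 1]%N
  + (b (j - m.+1) (basis_pos s) (basis_pos t) + b (j - m.+1) (basis_pos t) (basis_pos s))
     * basis_val s * basis_val t *+ (m < j)%N.

Variable c : nat -> nat -> nat -> int.
Hypothesis cE : forall s t j, gauss (c s t j.*2) (c s t j.*2.+1) = gauss_const s t j.

Lemma order_embedM (s t : 'I_quad_rank) :
  order_embed (unit_vector s) * order_embed (unit_vector t)
  = order_embed [ffun u : 'I_quad_rank => c s t u].
Proof.
have CE j : (j <= 2 * m)%N ->
    gauss_coord [ffun u : 'I_quad_rank => c s t u] j = gauss_const s t j.
  by move=> lej; rewrite -cE /gauss_coord !ffunE !inordK //; rewrite /quad_rank; lia.
have C0 : gauss_const s t 0 = ipow s * ipow t *+ ((s./2 == 0) && (t./2 == 0)).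
  by rewrite /gauss_const ltnn ltn0 !andbF !mulr0n !addr0.
(* Only the multiplicity of i + e_0 in a product can contribute an e_0 that is
   not doubled. *)
have c1 : (c s t 1)%:~R
    = ((s./2 == 0) && (t./2 == 0) && (odd s != odd t))%:R :> Qi.
  have := cE s t 0; rewrite C0 /ipow.
  case: (s./2 == 0); case: (t./2 == 0); rewrite /= ?mulr0n ?mulr1n;
    try by case/gauss_eq0=> _ ->.
  case: (odd s); case: (odd t); rewrite ?imag_sq ?mulr1 ?mul1r.
  - by rewrite -[-1 : Qi](gauss_int (-1)) => /gauss_inj[_ ->].
  - by case/gauss_inj=> _ ->.
  - by case/gauss_inj=> _ ->.
  - by case/(@gauss_inj _ _ 1 0) => _ ->.
have coord_unit0 (r : 'I_quad_rank) :
    (order_embed (unit_vector r)).1.1 = ipow r *+ (r./2 == 0).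
  exact: gauss_coord_unit.
have unit1 (r : 'I_quad_rank) :
    (unit_vector r (inord 1))%:~R = (odd r)%:R *+ (r./2 == 0) :> Qi.
  rewrite ffunE -val_eqE /= inordK //.
  have -> : (r == 1 :> nat) = odd r && (r./2 == 0) by lia.
  by case: (odd r); case: (r./2 == 0).
have one_half r : (r == 1)%N = odd r && (r./2 == 0) by lia.
rewrite two_step_mulE; congr (_, _, _).
- rewrite !coord_unit0 [RHS]CE // C0.
  by case: (s./2 == 0); case: (t./2 == 0); rewrite ?mulr0n ?mulr1n ?mulr0 ?mul0r.
- apply/rowP => j; have ltj := ltn_ord j.
  rewrite mxE !mxE !coord_unit0 !unit1 !gauss_coord_unit ?CE; try by lia.
  rewrite ffunE inordK // c1 /gauss_const (one_half s) (one_half t) eqSS.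
  have -> : (m < j.+1)%N = false by lia.
  rewrite mulr0n addr0.
  case: eqP => [->|_]; case: eqP => [->|_]; rewrite /= ?mulr0n ?mulr1n ?andbF;
    rewrite ?(mulr0, mul0r, addr0, add0r, mul0rn, mulr0n) //.
  + rewrite /ipow; case: (j == 0 :> nat); rewrite ?mulr0n ?mulr0 ?addr0 //.
    case: (odd s); case: (odd t); rewrite /= ?mulr1n ?mulr0n; ring.
  + by case: eqP => _; rewrite ?mulr1n ?mulr0n; ring.
  + by case: eqP => _; rewrite ?mulr1n ?mulr0n; ring.
- apply/rowP => k; have ltk := ltn_ord k.
  rewrite mxE [X in X + _]mxE polar_order_embed_unit !mxE !coord_unit0.
  rewrite !gauss_coord_unit ?CE; try by lia.
  rewrite /gauss_const; have -> : (m < (m + k).+1)%N by lia.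
  have -> : ((m + k).+1 - m.+1 = k)%N by lia.
  have -> : (m + k).+1 == 1 = false by lia.
  rewrite mulr0n addr0 mulr1n andbT; congr (_ + _).
  by case: (s./2 == 0); case: (t./2 == 0); case: (_ == _); case: (_ == _);
    rewrite /= ?(mulr0n, mulr1n, mulr0, mul0r); try ring.
Qed.

Lemma polar_diag v k :
  polar Q v v 0 k = 2%:R * \sum_(p < m) \sum_(q < m) b k p q * (v 0 p * v 0 q).
Proof.
have trE : v *m (Q k)^T *m v^T = (v *m Q k *m v^T)^T.
  by rewrite !trmx_mul trmxK mulmxA.
have <- : (v *m Q k *m v^T) 0 0
    = \sum_(p < m) \sum_(q < m) b k p q * (v 0 p * v 0 q).
  rewrite mxE; under eq_bigr => q _ do rewrite !mxE mulr_suml.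
  rewrite exchange_big; apply: eq_bigr => p _; apply: eq_bigr => q _.
  by rewrite !mxE; ring.
by rewrite mulr_natl mulr2n mxE mulmxDr mulmxDl trE mxE; congr (_ + _); rewrite mxE.
Qed.

Definition enc_consts (n : nat) (f : nat -> nat -> nat -> int) : nat :=
  code [:: n; code (mkseq (fun s => code (mkseq (fun t =>
    code (mkseq (fun u => enc_int (f s t u)) n)) n)) n)].

Let quad (k : nat) (y : nat -> Qi) : Qi :=
  \sum_(p < m) \sum_(q < m) b k p q * (y p * y q).

(** A zero lies over i or over -i; in the second case the opposite vector solves
    the same homogeneous system, so the first coordinate may be taken to be 1
    modulo 2Z[i]. *)
Lemma quadratic_order :
  exists2 x : order_input, enc_order x = enc_consts quad_rank c &
    has_zero (('X^2 + 1) ^+ 2) (order_ring x) <->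
    exists2 y : nat -> Qi,
      forall p, (p < m)%N -> exists g h, y p = (p == 0)%:R + 2%:R * gauss g h &
      forall k, (k < m)%N -> quad k y = 0.
Proof.
pose one : int_vectors quad_rank := unit_vector ord0.
have order_embed1 : order_embed one = 1.
  congr (_, _, _); first by rewrite gauss_coord_unit.
    apply/rowP => j; rewrite !mxE gauss_coord_unit ?ffunE; last by have := ltn_ord j; lia.
    by rewrite -val_eqE /= inordK // mulr0z mul0rn mulr0n mulr0 addr0.
  by apply/rowP => k; rewrite !mxE gauss_coord_unit //; have := ltn_ord k; lia.
have [A [e [eb ec zeroP]]] :=
  order_of_embedding order_embed_inj order_embed1 order_embedM.
exists (OrderInput eb ec).
  have enc_enum (g : 'I_quad_rank -> nat) (f : nat -> nat) : (forall i, g i = f i) ->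
      enc_seq g (enum 'I_quad_rank) = code (mkseq f quad_rank).
    move=> gE; rewrite /enc_seq /mkseq -val_enum_ord -map_comp; congr code.
    exact: eq_map.
  apply: (congr1 (fun a => code [:: quad_rank; a])).
  by apply: (enc_enum) => s; apply: (enc_enum) => t; apply: (enc_enum).
rewrite zeroP /=.
have zeroE u : eval_int_poly (('X^2 + 1) ^+ 2) (order_embed u) = 0 <->
    gauss_coord u 0 ^+ 2 = -1 /\
    polar Q (order_embed u).1.2 (order_embed u).1.2 = 0.
  by rewrite eval_X2p1_sq two_step_zero ?Qi_two_neq0.
split=> [[u /zeroE[]]|].
  case/gauss_sqN1 => _ u1 /rowP P0; pose sg : int := u (inord 1).
  have {}u1 : sg = 1 \/ sg = -1 := u1.
  exists (fun p => oapp (fun i => sg%:~R * (order_embed u).1.2 0 i) 0 (insub p)).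
    move=> p ltp; rewrite insubT /= mxE.
    exists (sg * u (inord p.+1.*2)), (sg * u (inord p.+1.*2.+1)).
    have -> : gauss (sg * u (inord p.+1.*2)) (sg * u (inord p.+1.*2.+1))
      = sg%:~R * gauss_coord u p.+1.
      by rewrite -gauss_int -gaussM !mul0r subr0 addr0.
    rewrite mulrDr mulrCA; congr (_ + _).
    by rewrite -/sg; case: u1 => -> /=; case: (p == 0); rewrite ?mulr1n ?mulr0n ?mulr0.
  move=> k ltk; have := P0 (Ordinal ltk); rewrite polar_diag [RHS]mxE => /eqP.
  rewrite mulf_eq0 (negPf Qi_two_neq0) /= => /eqP quad0.
  rewrite /quad -[RHS](mulr0 (sg%:~R * sg%:~R)) -[in RHS]quad0 mulr_sumr.
  apply: eq_bigr => p _; rewrite mulr_sumr; apply: eq_bigr => q _.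
  by rewrite !valK /=; ring.
case=> y yP quad0.
have [f fP] := fin_all_exists (fun i : 'I_m => yP i (ltn_ord i)).
have [h hP] := fin_all_exists fP.
pose gh j := oapp (fun i => (f i, h i)) (0, 0) (insub j).
pose u : int_vectors quad_rank := [ffun s : 'I_quad_rank =>
  if s./2 == 0 then (odd s)%:R
  else if odd s then (gh s./2.-1).2 else (gh s./2.-1).1].
have uV (i : 'I_m) : (order_embed u).1.2 0 i = y i.
  have lti := ltn_ord i; rewrite mxE /gauss_coord !ffunE !inordK;
  try by rewrite /quad_rank; lia.
  rewrite /= !uphalf_double !doubleK !odd_double /= /gh valK /= hP.
  by case: (i == 0 :> nat).
exists u; apply/zeroE; split.
  by rewrite /gauss_coord !ffunE !inordK //= expr2 imag_sq.
apply/rowP => k; rewrite polar_diag [RHS]mxE.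
under eq_bigr => p _ do under eq_bigr => q _ do rewrite !uV.
by rewrite [X in _ * X](quad0 k) ?mulr0.
Qed.
End QuadraticOrder.

(** * Computable functions with Gaussian integer values *)

(** Both components are kept as differences of natural numbers, for which the ring
    operations need no case distinction on signs. *)
Definition computable_gauss (T : Type) (ctx : T -> seq nat) (F : T -> Qi) : Prop :=
  exists a b c d : T -> nat,
    [/\ computable ctx a, computable ctx b, computable ctx c, computable ctx d &
        forall x, F x = gauss ((a x)%:Z - (b x)%:Z) ((c x)%:Z - (d x)%:Z)].

Section ComputableG.
Variables (T : Type) (ctx : T -> seq nat).
Implicit Types F G : T -> Qi.

Lemma computable_gauss_nat (F : T -> nat) :
  computable ctx F -> computable_gauss ctx (fun x => (F x)%:R).
Proof.
move=> cF; have c0 := computable_const 0 ctx.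
exists F, (fun=> 0), (fun=> 0), (fun=> 0); split=> // x.
by rewrite !subr0 gauss_int.
Qed.

Lemma computable_gauss_imag : computable_gauss ctx (fun=> imag).
Proof.
have [c0 c1] := (computable_const 0 ctx, computable_const 1 ctx).
by exists (fun=> 0), (fun=> 0), (fun=> 1), (fun=> 0); split.
Qed.

Lemma computable_gauss_opp F :
  computable_gauss ctx F -> computable_gauss ctx (fun x => - F x).
Proof.
move=> [a [b [c [d [ca cb cc cd FE]]]]]; exists b, a, d, c; split=> // x.
by rewrite FE -gaussN !opprB.
Qed.

Lemma computable_gauss_add F G :
  computable_gauss ctx F -> computable_gauss ctx G ->
  computable_gauss ctx (fun x => F x + G x).
Proof.
move=> [a [b [c [d [ca cb cc cd FE]]]]] [a' [b' [c' [d' [ca' cb' cc' cd' GE]]]]].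
exists (fun x => a x + a' x)%N, (fun x => b x + b' x)%N,
  (fun x => c x + c' x)%N, (fun x => d x + d' x)%N.
split; try exact: computable_add.
by move=> x; rewrite FE GE -gaussD; congr gauss; rewrite !PoszD; ring.
Qed.

Lemma computable_gauss_mul F G :
  computable_gauss ctx F -> computable_gauss ctx G ->
  computable_gauss ctx (fun x => F x * G x).
Proof.
move=> [a [b [c [d [ca cb cc cd FE]]]]] [a' [b' [c' [d' [ca' cb' cc' cd' GE]]]]].
exists (fun x => a x * a' x + b x * b' x + (c x * d' x + d x * c' x))%N,
  (fun x => a x * b' x + b x * a' x + (c x * c' x + d x * d' x))%N,
  (fun x => a x * c' x + b x * d' x + (c x * a' x + d x * b' x))%N,
  (fun x => a x * d' x + b x * c' x + (c x * b' x + d x * a' x))%N.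
split; try by do !apply: computable_add; apply: computable_mul.
by move=> x; rewrite FE GE -gaussM; congr gauss; rewrite !(PoszD, PoszM); ring.
Qed.

Lemma computable_gauss_mulb F (P : T -> bool) :
  computable_gauss ctx F -> computable ctx (fun x => nat_of_bool (P x)) ->
  computable_gauss ctx (fun x => F x *+ P x).
Proof.
move=> cF /computable_gauss_nat cP.
have [a [b [c [d [ca cb cc cd E]]]]] := computable_gauss_mul cF cP.
by exists a, b, c, d; split=> // x; rewrite -E mulr_natr.
Qed.

Lemma computable_gauss_if F G (P : T -> bool) :
  computable_gauss ctx F -> computable_gauss ctx G ->
  computable ctx (fun x => nat_of_bool (P x)) ->
  computable_gauss ctx (fun x => if P x then F x else G x).
Proof.
move=> cF cG cP; have cP' : computable ctx (fun x => nat_of_bool (~~ P x)).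
  apply: (computable_ext (F := fun x => if P x then 0%N else 1%N)) => [x|].
    by case: (P x).
  by apply: computable_if => //; apply: computable_const.
have [a [b [c [d [ca cb cc cd E]]]]] :=
  computable_gauss_add (computable_gauss_mulb cF cP) (computable_gauss_mulb cG cP').
exists a, b, c, d; split=> // x; rewrite -E.
by case: (P x); rewrite /= !(mulr0n, mulr1n) ?addr0 ?add0r.
Qed.

Lemma computable_gauss_sum m (F : T -> nat -> Qi) n :
    (forall x, size (ctx x) = m) ->
  computable_gauss (ctx_cons ctx) (fun p => F p.2 p.1) -> computable ctx n ->
  computable_gauss ctx (fun x => \sum_(i < n x) F x i).
Proof.
move=> szctx [a [b [c [d [ca cb cc cd E]]]]] cn.
pose S (f : nat * T -> nat) x := (\sum_(i < n x) f ((i : nat), x))%N.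
have cS f : computable (ctx_cons ctx) f -> computable ctx (S f).
  move=> cf; apply: (computable_sum (F := fun x i => f (i, x)) szctx) => //.
  by apply: computable_ext cf => -[].
exists (S a), (S b), (S c), (S d); split; try exact: cS.
move=> x; rewrite /S; elim: (n x) => [|k IHk]; first by rewrite !big_ord0.
rewrite !big_ord_recr /= IHk (E (k, x)) -gaussD; congr gauss; rewrite !PoszD; ring.
Qed.

Lemma enc_int_sub (p q : nat) :
  enc_int (p%:Z - q%:Z) = (if q <= p then (p - q).*2 else (q - p).-1.*2.+1)%N.
Proof.
case: leqP => [leqp|ltpq]; first by rewrite subzn.
rewrite -opprB subzn ?(ltnW ltpq) //.
by move: ltpq; rewrite -subn_gt0; case: (q - p)%N.
Qed.

Lemma computable_enc_int_sub a b :
  computable ctx a -> computable ctx b ->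
  computable ctx (fun x => enc_int ((a x)%:Z - (b x)%:Z)).
Proof.
move=> ca cb; apply: (computable_ext (F := fun x =>
  if b x <= a x then (a x - b x).*2 else (b x - a x).-1.*2.+1)%N) => [x|].
  by rewrite enc_int_sub.
apply: computable_if; first exact: computable_leq.
  exact/computable_double/computable_sub.
exact/computable_succ/computable_double/computable_pred/computable_sub.
Qed.

(** Only the final values need their signs. *)
Lemma computable_gauss_components F : computable_gauss ctx F ->
  exists re im : T -> int, [/\ computable ctx (fun x => enc_int (re x)),
    computable ctx (fun x => enc_int (im x)) & forall x, F x = gauss (re x) (im x)].
Proof.
move=> [a [b [c [d [ca cb cc cd E]]]]].
exists (fun x => (a x)%:Z - (b x)%:Z), (fun x => (c x)%:Z - (d x)%:Z).
by split=> //; apply: computable_enc_int_sub.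
Qed.

Definition dec_int (n : nat) : int := if odd n then Negz n./2 else Posz n./2.

Lemma enc_intK : cancel enc_int dec_int.
Proof.
by case=> n; rewrite /dec_int /enc_int /= odd_double /= ?uphalf_double ?doubleK.
Qed.

Lemma computable_gauss_dec_int (F : T -> nat) :
  computable ctx F -> computable_gauss ctx (fun x => (dec_int (F x))%:~R).
Proof.
move=> cF; have [c0 ch] := (computable_const 0 ctx, computable_half cF).
have co := computable_odd cF.
exists (fun x => if odd (F x) then 0 else (F x)./2)%N,
  (fun x => if odd (F x) then (F x)./2.+1 else 0)%N, (fun=> 0)%N, (fun=> 0)%N.
split=> //; try by apply: computable_if => //; apply: computable_succ.
move=> x; rewrite subrr gauss_int /dec_int.
by case: (odd (F x)); rewrite ?NegzE ?sub0r ?subr0.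
Qed.
End ComputableG.

(** * The quadratic system of an instance *)

(** The term with code r is (num / den) X^l, where l has code [term_mono r].  For
    a number r that is the code of no term, den may be 0. *)
Definition term_mono (r : nat) : nat := code_head (code_tail r).

Definition term_den (r : nat) : Qi :=
  (dec_int (code_head (code_tail (code_head (code_head r)))))%:~R
  * (dec_int (code_head (code_tail (code_head (code_tail (code_head r))))))%:~R.

Definition term_num (r : nat) : Qi :=
  (dec_int (code_head (code_head (code_head r))))%:~R
    * (dec_int (code_head (code_tail (code_head (code_tail (code_head r))))))%:~R
  + imag * ((dec_int (code_head (code_head (code_tail (code_head r)))))%:~R
    * (dec_int (code_head (code_tail (code_head (code_head r)))))%:~R).

(** The code of the exponent list of the variable X_j, namely j zeros and a 1. *)
Definition var_code (j : nat) : nat := (3 * 2 ^ j - 1)%N.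

(** Factorization of a monomial X^l as X_j X^l', where j is the position of the
    first nonzero exponent.  If l has code c, then c + 1 = 2^j (2d + 1) where d is
    the code of the list that starts at position j, with its first entry
    decreased; d = 0 means that l consists of zeros.  In this case both factors
    are the monomial 1, of code 0. *)
Definition mono_var (c : nat) : nat :=
  if code_tail c.+1 == 0%N then 0%N else var_code (code_head c.+1).

Definition mono_rest (c : nat) : nat :=
  if code_tail c.+1 == 0%N then 0%N else (c - 2 ^ code_head c.+1 * code_tail c.+1)%N.

(** Unknowns of the quadratic system: T, W and U, then, interleaved, the values of
    monomials and of polynomials.  The homogenizing unknown Z is [ix_mono 0], the
    value of the monomial 1.  The step 3 gives the unknowns the same range as the
    three interleaved families of equations. *)
Local Notation ix_T := 0%N.
Local Notation ix_W := 1%N.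
Local Notation ix_U := 2%N.
Definition ix_mono (c : nat) : nat := (3 * c + 3)%N.
Definition ix_sum (s : nat) : nat := (3 * s + 4)%N.
Definition row_mono (c : nat) : nat := (3 * c + 1)%N.
Definition row_sum (c : nat) : nat := (3 * c + 2)%N.
Definition row_poly (c : nat) : nat := (3 * c + 3)%N.

Definition elem_coef (k0 p0 q0 k p q : nat) : Qi :=
  [&& k == k0, p == p0 & q == q0]%:R.

Definition poly_code (e l : nat) : nat := code_nth (code_head (code_tail e)) l.

(** The equations contributed by the number c, as bilinear forms (see [mono_eqn],
    [sum_eqn] and [poly_eqn] for their values).  The recursion on term lists is
    multiplied by [term_den] twice: once to clear the denominator, and once more
    so that it becomes trivial when c starts with the code of no term and the
    denominator is 0. *)
Definition local_coef (e c k p q : nat) : Qi :=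
  (elem_coef (row_mono c) (ix_mono 0) (ix_mono c) k p q
   - elem_coef (row_mono c) (ix_mono (mono_var c)) (ix_mono (mono_rest c)) k p q)
  + (term_den (code_head c) * (term_den (code_head c) *
      (elem_coef (row_sum c) (ix_mono 0) (ix_sum c) k p q
       - elem_coef (row_sum c) (ix_mono 0) (ix_sum (code_tail c)) k p q)
     - term_num (code_head c) *
        elem_coef (row_sum c) (ix_mono 0) (ix_mono (term_mono (code_head c))) k p q))
  + elem_coef (row_poly c) (ix_mono 0) (ix_sum (poly_code e c)) k p q.

Definition system_coef (e k p q : nat) : Qi :=
  (elem_coef 0 (ix_mono 0) ix_W k p q - elem_coef 0 ix_U ix_U k p q
   - elem_coef 0 ix_U ix_T k p q - 2%:R * elem_coef 0 ix_T ix_T k p q)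
  + \sum_(c < e.+1) local_coef e c k p q.

Definition system_size (e : nat) : nat := (3 * e.+1 + 3)%N.

Lemma mono_var_leq c : (mono_var c <= c)%N.
Proof.
rewrite /mono_var /var_code; case: eqP => // tl0.
have [//|cE] := codeP c.+1.
have : (3 * 2 ^ code_head c.+1 <= c.+1)%N.
  by rewrite {2}cE mulnC leq_mul2l; apply/orP; right; lia.
by lia.
Qed.

Lemma mono_rest_leq c : (mono_rest c <= c)%N.
Proof. by rewrite /mono_rest; case: eqP => // _; apply: leq_subr. Qed.

Lemma poly_code_leq e l : (poly_code e l <= e)%N.
Proof.
rewrite (leq_trans (code_nth_leq _ _)) // (leq_trans (code_head_leq _)) //.
exact: code_tail_leq.
Qed.

Lemma term_mono_leq r : (term_mono r <= r)%N.
Proof. by rewrite (leq_trans (code_head_leq _)) // code_tail_leq. Qed.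

(** * Computability of the reduction *)

Lemma computable_var_code T (ctx : T -> seq nat) F :
  computable ctx F -> computable ctx (fun x => var_code (F x)).
Proof.
move=> cF; apply: computable_sub; last exact: computable_const.
by apply: computable_mul; [exact: computable_const | exact: computable_exp2].
Qed.

Lemma computable_mono_var T (ctx : T -> seq nat) F :
  computable ctx F -> computable ctx (fun x => mono_var (F x)).
Proof.
move=> cF; have c0 := computable_const 0 ctx; have cF1 := computable_succ cF.
apply: computable_if => //.
  by apply: computable_eq => //; apply: computable_code_tail.
exact/computable_var_code/computable_code_head.
Qed.

Lemma computable_mono_rest T (ctx : T -> seq nat) F :
  computable ctx F -> computable ctx (fun x => mono_rest (F x)).
Proof.
move=> cF; have c0 := computable_const 0 ctx; have cF1 := computable_succ cF.
apply: computable_if => //.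
  by apply: computable_eq => //; apply: computable_code_tail.
apply: computable_sub => //; apply: computable_mul; last exact: computable_code_tail.
exact/computable_exp2/computable_code_head.
Qed.

Lemma computable_gauss_elem_coef T (ctx : T -> seq nat) K0 P0 Q0 K P Q :
  computable ctx K0 -> computable ctx P0 -> computable ctx Q0 ->
  computable ctx K -> computable ctx P -> computable ctx Q ->
  computable_gauss ctx (fun x => elem_coef (K0 x) (P0 x) (Q0 x) (K x) (P x) (Q x)).
Proof.
by move=> *; apply: computable_gauss_nat; do !apply: computable_and; apply: computable_eq.
Qed.

Ltac comp :=
  lazymatch goal with
  | |- computable _ (fun _ => ?n) => exact: computable_const
  | |- computable _ (fun x => nat_of_bool (andb (@?a x) (@?b x))) =>
      apply: computable_and; comp
  | |- computable _ (fun x => nat_of_bool (eq_op (@?a x) (@?b x))) =>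
      apply: computable_eq; comp
  | |- computable _ (fun x => nat_of_bool (leq (@?a x) (@?b x))) =>
      apply: computable_leq; comp
  | |- computable _ (fun x => nat_of_bool (odd (@?a x))) =>
      apply: computable_odd; comp
  | |- computable _ (fun x => if _ then _ else _) =>
      apply: computable_if; comp
  | |- computable _ S => apply: computable_succ; comp
  | |- computable _ (fun x => S (@?a x)) => apply: computable_succ; comp
  | |- computable _ (fun x => addn (@?a x) (@?b x)) => apply: computable_add; comp
  | |- computable _ (fun x => subn (@?a x) (@?b x)) => apply: computable_sub; comp
  | |- computable _ (fun x => muln (@?a x) (@?b x)) => apply: computable_mul; comp
  | |- computable _ (fun x => predn (@?a x)) => apply: computable_pred; comp
  | |- computable _ (fun x => half (@?a x)) => apply: computable_half; comp
  | |- computable _ (fun x => code_head (@?a x)) => apply: computable_code_head; comp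
  | |- computable _ (fun x => code_tail (@?a x)) => apply: computable_code_tail; comp
  | |- computable _ (fun x => code_nth (@?a x) (@?b x)) => apply: computable_code_nth; comp
  | |- computable _ (fun x => mono_var (@?a x)) => apply: computable_mono_var; comp
  | |- computable _ (fun x => mono_rest (@?a x)) => apply: computable_mono_rest; comp
  | |- computable_gauss _ (fun x => elem_coef _ _ _ _ _ _) =>
      apply: computable_gauss_elem_coef; comp
  | |- computable_gauss _ (fun x => Algebra.add (@?a x) (@?b x)) =>
      apply: computable_gauss_add; comp
  | |- computable_gauss _ (fun x => Algebra.opp (@?a x)) =>
      apply: computable_gauss_opp; comp
  | |- computable_gauss _ (fun x => GRing.mul (@?a x) (@?b x)) =>
      apply: computable_gauss_mul; comp
  | |- computable_gauss _ (fun x => intmul _ (dec_int (@?a x))) =>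
      apply: computable_gauss_dec_int; comp
  | |- computable_gauss _ (fun x => Algebra.natmul _ (nat_of_bool (@?a x))) =>
      apply: computable_gauss_mulb; comp
  | |- computable_gauss _ (fun x => Algebra.natmul (GRing.one _) (@?a x)) =>
      apply: computable_gauss_nat; comp
  | |- computable_gauss _ (fun x => if _ then _ else _) =>
      apply: computable_gauss_if; comp
  | |- computable_gauss _ (fun _ => imag) => exact: computable_gauss_imag
  | |- computable_gauss _ (fun _ => GRing.one _) =>
      exact: (computable_gauss_nat (F := fun _ => 1%N) (computable_const 1 _))
  | |- computable_gauss _ (fun _ => Algebra.zero) =>
      exact: (computable_gauss_nat (F := fun _ => 0%N) (computable_const 0 _))
  | |- computable _ _ => comp_var
  | |- _ => idtac
  end.

Local Notation ctx4 := (fun p : nat * (nat * (nat * nat)) =>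
  [:: p.1; p.2.1; p.2.2.1; p.2.2.2]).

Lemma computable_gauss_comp T T' (ctx : T -> seq nat) (ctx' : T' -> seq nat)
    (F : T' -> Qi) (h : T -> T') (Gs : seq (T -> nat)) :
    (forall x, ctx' (h x) = [seq G x | G <- Gs]) ->
  computable_gauss ctx' F -> all_computable ctx Gs ->
  computable_gauss ctx (fun x => F (h x)).
Proof.
move=> hE [a [b [c [d [ca cb cc cd FE]]]]] cGs.
exists (a \o h), (b \o h), (c \o h), (d \o h); split;
  try exact: computable_comp hE _ cGs.
by move=> x; rewrite FE.
Qed.

Lemma computable_gauss_system_coef T (ctx : T -> seq nat) E K P Q :
  computable ctx E -> computable ctx K -> computable ctx P -> computable ctx Q ->
  computable_gauss ctx (fun x => system_coef (E x) (K x) (P x) (Q x)).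
Proof.
move=> cE cK cP cQ.
apply: (computable_gauss_comp (ctx' := ctx4) (h := fun x => (E x, (K x, (P x, Q x))))
  (F := fun p => system_coef p.1 p.2.1 p.2.2.1 p.2.2.2) (Gs := [:: E; K; P; Q])) => //.
rewrite /system_coef; apply: computable_gauss_add; first by comp.
apply: (computable_gauss_sum (m := 4) (n := fun p => p.1.+1)
  (F := fun p c => local_coef p.1 c p.2.1 p.2.2.1 p.2.2.2)) => //; last by comp.
rewrite /local_coef /term_den /term_num /term_mono /poly_code /ix_mono /ix_sum.
rewrite /row_mono /row_sum /row_poly.
by comp.
Qed.

Lemma computable_enc_consts (n : nat -> nat) (c : nat -> nat -> nat -> nat -> int) :
  computable ctx1 n ->
  computable ctx4 (fun p => enc_int (c p.2.2.2 p.2.2.1 p.2.1 p.1)) ->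
  computable ctx1 (fun e => enc_consts (n e) (c e)).
Proof.
move=> cn cc; rewrite /enc_consts.
have codeE a b : code [:: a; b] = (2 ^ a * (2 ^ b).*2.+1)%N.
  by rewrite /= muln1.
apply: (computable_ext (F := fun e => (2 ^ n e * (2 ^ code (mkseq
    (fun s => code (mkseq (fun t => code (mkseq
      (fun u => enc_int (c e s t u)) (n e))) (n e))) (n e))).*2.+1)%N)).
  by move=> e; rewrite codeE.
apply: computable_mul; first exact: computable_exp2.
apply/computable_succ/computable_double/computable_exp2.
apply: (computable_mkseq (m := 1) (n := n) (F := fun e s => code (mkseq
  (fun t => code (mkseq (fun u => enc_int (c e s t u)) (n e))) (n e)))) => //.
apply: (computable_mkseq (m := 2) (n := fun p : nat * nat => n p.2)
  (F := fun p t => code (mkseq (fun u => enc_int (c p.2 p.1 t u)) (n p.2)))) => //.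
  apply: (computable_mkseq (m := 3) (n := fun p : nat * (nat * nat) => n p.2.2)
    (F := fun p u => enc_int (c p.2.2 p.2.1 p.1 u))) => //.
  by apply: (computable_app1 (f := n)) => //; comp.
by apply: (computable_app1 (f := n)) => //; comp.
Qed.

Lemma structure_constants_computable :
  exists c : nat -> nat -> nat -> nat -> int,
    computable ctx1 (fun e => enc_consts (quad_rank (system_size e)) (c e)) /\
    forall e s t j, gauss (c e s t j.*2) (c e s t j.*2.+1)
      = gauss_const (system_size e) (system_coef e) s t j.
Proof.
pose C (p : nat * (nat * (nat * nat))) :=
  gauss_const (system_size p.2.2.2) (system_coef p.2.2.2) p.2.2.1 p.2.1 p.1.
have : computable_gauss ctx4 C.
  rewrite /C /gauss_const /ipow /basis_val /basis_pos /system_size /ipow.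
  by comp; apply: computable_gauss_system_coef; comp.
case/computable_gauss_components=> re [im [cre cim CE]].
exists (fun e s t u =>
  if odd u then im (u./2, (t, (s, e))) else re (u./2, (t, (s, e)))).
split; last first.
  move=> e s t j; rewrite /= odd_double /= uphalf_double doubleK.
  by rewrite -(CE (j, (t, (s, e)))).
apply: computable_enc_consts; first by rewrite /quad_rank /system_size; comp.
have half_ctx F : computable ctx4 F ->
    computable ctx4 (fun p => F (p.1./2, p.2)).
  move=> cF; apply: (computable_comp (h := fun p => (p.1./2, p.2))
    (Gs := [:: (fun p => p.1./2); (fun p => p.2.1); (fun p => p.2.2.1);
               (fun p => p.2.2.2)]) _ cF) => //.
  by do !split; comp.
apply: (computable_ext (F := fun p => if odd p.1 then enc_int (im (p.1./2, p.2))
   else enc_int (re (p.1./2, p.2)))) => [[u [t [s e]]]|] /=; first by case: (odd u).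
apply: computable_if; first by comp.
  exact: (half_ctx (fun p => enc_int (im p))).
exact: (half_ctx (fun p => enc_int (re p))).
Qed.

(** * The equations of the quadratic system *)

Section SystemForms.
Variables (e : nat) (y : nat -> Qi).
Let m := system_size e.

Definition form_value (f : nat -> nat -> Qi) : Qi :=
  \sum_(p < m) \sum_(q < m) f p q * (y p * y q).

Lemma form_valueD f g :
  form_value (fun p q => f p q + g p q) = form_value f + form_value g.
Proof.
rewrite /form_value -big_split; apply: eq_bigr => p _ /=.
by rewrite -big_split; apply: eq_bigr => q _; rewrite mulrDl.
Qed.

Lemma form_valueZ a f : form_value (fun p q => a * f p q) = a * form_value f.
Proof.
rewrite /form_value mulr_sumr; apply: eq_bigr => p _.
by rewrite mulr_sumr; apply: eq_bigr => q _; rewrite -mulrA.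
Qed.

Lemma form_valueB f g :
  form_value (fun p q => f p q - g p q) = form_value f - form_value g.
Proof.
rewrite -[form_value g]mul1r -mulNr -form_valueZ -form_valueD.
by apply: eq_bigr => p _; apply: eq_bigr => q _; rewrite mulN1r.
Qed.

Lemma form_value_sum n (f : nat -> nat -> nat -> Qi) :
  form_value (fun p q => \sum_(c < n) f c p q) = \sum_(c < n) form_value (f c).
Proof.
rewrite /form_value [RHS]exchange_big; apply: eq_bigr => p _ /=.
by rewrite [RHS]exchange_big; apply: eq_bigr => q _; rewrite mulr_suml.
Qed.

(** An index beyond the number of unknowns would make the term disappear, hence
    the bounds. *)
Lemma form_value_elem k0 p0 q0 k : (p0 < m)%N -> (q0 < m)%N ->
  form_value (elem_coef k0 p0 q0 k) = (k == k0)%:R * (y p0 * y q0).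
Proof.
move=> ltp ltq; rewrite /form_value (bigD1 (Ordinal ltp)) //= [X in _ + X]big1.
  rewrite addr0 (bigD1 (Ordinal ltq)) //= big1 => [|q nq].
    by rewrite addr0 /elem_coef !eqxx !andbT.
  by rewrite /elem_coef -[q == q0 :> nat]/(q == Ordinal ltq) (negPf nq) !andbF mul0r.
move=> p np; rewrite big1 // => q _.
by rewrite /elem_coef -[p == p0 :> nat]/(p == Ordinal ltp) (negPf np) andbF mul0r.
Qed.

Definition scale_eqn :=
  y (ix_mono 0) * y ix_W - y ix_U * y ix_U - y ix_U * y ix_T
  - 2%:R * (y ix_T * y ix_T).
Definition mono_eqn c :=
  y (ix_mono 0) * y (ix_mono c)
  - y (ix_mono (mono_var c)) * y (ix_mono (mono_rest c)).
Definition sum_eqn c :=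
  term_den (code_head c) * (term_den (code_head c) *
    (y (ix_mono 0) * y (ix_sum c) - y (ix_mono 0) * y (ix_sum (code_tail c)))
   - term_num (code_head c) * (y (ix_mono 0) * y (ix_mono (term_mono (code_head c))))).
Definition poly_eqn c := y (ix_mono 0) * y (ix_sum (poly_code e c)).

Lemma form_value_system k :
  form_value (system_coef e k) = (k == 0%N)%:R * scale_eqn +
    \sum_(c < e.+1) ((k == row_mono c)%:R * mono_eqn c + (k == row_sum c)%:R * sum_eqn c
                      + (k == row_poly c)%:R * poly_eqn c).
Proof.
have ltZ c : (c <= e)%N -> (ix_mono c < m)%N by rewrite /m /system_size /ix_mono; lia.
have ltS c : (c <= e)%N -> (ix_sum c < m)%N by rewrite /m /system_size /ix_sum; lia.
rewrite [LHS]form_valueD !form_valueB form_valueZ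
  (form_value_sum _ (fun c => local_coef e c k)).
have lt2 : (2 < m)%N by rewrite /m /system_size; lia.
rewrite !form_value_elem ?ltZ ?(ltnW lt2) //; congr (_ + _).
  by rewrite /scale_eqn; ring.
apply: eq_bigr => c _; have lec : (c <= e)%N by rewrite -ltnS.
rewrite [LHS]form_valueD form_valueD form_valueB form_valueZ form_valueB.
rewrite !form_valueZ form_valueB.
rewrite !form_value_elem ?ltZ ?ltS ?poly_code_leq //;
  rewrite ?(leq_trans (code_tail_leq _)) ?(leq_trans (mono_var_leq _))
    ?(leq_trans (mono_rest_leq _)) ?(leq_trans (term_mono_leq _))
    ?(leq_trans (code_head_leq _)) //.
by rewrite /mono_eqn /sum_eqn /poly_eqn; ring.
Qed.

(** Every index k selects at most one equation, the row indices of the three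
    families and of the first equation being distinct. *)
Lemma system_forms_zero :
  (forall k, (k < m)%N -> form_value (system_coef e k) = 0) <->
  scale_eqn = 0 /\
  forall c, (c <= e)%N -> [/\ mono_eqn c = 0, sum_eqn c = 0 & poly_eqn c = 0].
Proof.
split=> [all0 | [e0 eqs0] k _]; last first.
  rewrite form_value_system e0 mulr0 add0r big1 // => c _.
  by have [|-> -> ->] := eqs0 c; rewrite ?mulr0 ?addr0 // -ltnS.
split.
  have := all0 0%N isT; rewrite form_value_system mul1r big1 ?addr0 // => c _.
  by rewrite /row_mono /row_sum /row_poly !addnS !mul0r !addr0.
move=> c lec; rewrite -ltnS in lec.
have pick (E : nat -> nat) (X : Qi) : (E c < m)%N ->
    E c != 0%N ->
    (forall c' : 'I_e.+1, (E c == row_mono c')%:R * mono_eqn c'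
       + (E c == row_sum c')%:R * sum_eqn c'
       + (E c == row_poly c')%:R * poly_eqn c' = if c' == Ordinal lec then X else 0) ->
    X = 0.
  move=> ltm /negPf ne0 H; have := all0 _ ltm; rewrite form_value_system ne0 mul0r add0r.
  by under eq_bigr => c' _ do rewrite H; rewrite -big_mkcond big_pred1_eq.
have eqs (c' : nat) :
    ((row_mono c == row_mono c') = (c' == c)) * ((row_sum c == row_mono c') = false)
    * ((row_poly c == row_mono c') = false) * ((row_mono c == row_sum c') = false)
    * ((row_sum c == row_sum c') = (c' == c)) * ((row_poly c == row_sum c') = false)
    * ((row_mono c == row_poly c') = false) * ((row_sum c == row_poly c') = false)
    * ((row_poly c == row_poly c') = (c' == c)).
  by rewrite /row_mono /row_sum /row_poly; do !split; lia.
split; [apply: (pick row_mono) | apply: (pick row_sum) | apply: (pick row_poly)];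
  try by rewrite /m /system_size /row_mono /row_sum /row_poly; lia.
all: move=> c'; rewrite -(inj_eq val_inj) /= !eqs; case: eqP => [->|_].
all: by rewrite !(mul0r, mul1r, addr0, add0r).
Qed.
End SystemForms.



(** * Tables of monomials *)

Definition monomial (v : nat -> Qi) (l : seq nat) : Qi :=
  \prod_(i < size l) v i ^+ nth 0 l i.

Lemma monomial_cons v a l :
  monomial v (a :: l) = v 0%N ^+ a * monomial (v \o succn) l.
Proof. by rewrite /monomial big_ord_recl. Qed.

Lemma monomial_zeros v j l :
  monomial v (nseq j 0%N ++ l) = monomial (fun i => v (j + i)%N) l.
Proof.
elim: j v => [|j IHj] v //=; rewrite monomial_cons expr0 mul1r IHj.
by apply: eq_bigr => i _; rewrite /= addSn.
Qed.

Lemma monomial_step v j a l :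
  monomial v (nseq j 0%N ++ a.+1 :: l) = v j * monomial v (nseq j 0%N ++ a :: l).
Proof. by rewrite !monomial_zeros !monomial_cons addn0 exprS mulrA. Qed.

Lemma leading_zeros l : exists j, l = nseq j 0%N \/
  exists a r, l = nseq j 0%N ++ a.+1 :: r.
Proof.
elim: l => [|[|a] l [j IHl]]; first by exists 0%N; left.
  exists j.+1; case: IHl => [->|[b [r ->]]]; [by left | by right; exists b, r].
by exists 0%N; right; exists a, l.
Qed.

(** Prepending a zero maps c to 2c + 1, which is doubling on successors. *)
Lemma code_zeros j l : (code (nseq j 0%N ++ l)).+1 = (2 ^ j * (code l).+1)%N.
Proof.
elim: j => [|j IHj]; first by rewrite mul1n.
have -> : code (nseq j.+1 0%N ++ l) = (code (nseq j 0%N ++ l)).*2.+1.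
  by rewrite /= mul1n.
by rewrite -doubleS IHj expnS -mulnA mul2n.
Qed.

Lemma mono_split_zeros j : mono_var (code (nseq j 0%N)) = 0%N /\
  mono_rest (code (nseq j 0%N)) = 0%N.
Proof.
have E := code_zeros j [::]; rewrite cats0 in E.
by rewrite /mono_var /mono_rest E (code_tail_pow j 0).
Qed.

Lemma mono_split j a r : let c := code (nseq j 0%N ++ a.+1 :: r) in
  [/\ mono_var c = var_code j, mono_rest c = code (nseq j 0%N ++ a :: r) &
      (mono_rest c < c)%N].
Proof.
move=> c; have := code_zeros j (a.+1 :: r); rewrite -/c.
have -> : code (a.+1 :: r) = (code (a :: r)).*2 by rewrite /= expnS -mulnA mul2n.
have code_gt0 : (0 < code (a :: r))%N by rewrite /= muln_gt0 expn_gt0.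
move: code_gt0 (code_zeros j (a :: r)); set d := code (a :: r).
set b := code _ => d_gt0 bE cE.
have -> : mono_rest c = b.
  rewrite /mono_rest cE code_tail_pow code_head_pow eqn0Ngt d_gt0 /=.
  by move: bE cE; rewrite !mulnS; set P := (2 ^ j)%N; rewrite -muln2 mulnA; lia.
split=> //; first by rewrite /mono_var cE code_tail_pow code_head_pow eqn0Ngt d_gt0.
by rewrite -ltnS cE bE ltn_pmul2l ?expn_gt0 //; lia.
Qed.

Lemma code_variable j : code (nseq j 0%N ++ [:: 1%N]) = var_code j.
Proof. by apply: succn_inj; rewrite code_zeros /var_code /=; lia. Qed.

Section MonomialTable.
Variable v : nat -> Qi.
Definition monomial_table c := monomial v (decode c).

Lemma monomial_table0 : monomial_table 0 = 1.
Proof. by rewrite /monomial_table /monomial big_ord0. Qed.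

Lemma monomial_tableE c :
  monomial_table c = monomial_table (mono_var c) * monomial_table (mono_rest c).
Proof.
rewrite /monomial_table -{2 3}[c]CodeSeq.decodeK.
have [j [->|[a [r ->]]]] := leading_zeros (decode c).
  have [-> ->] := mono_split_zeros j.
  by rewrite /= -[nseq j 0%N]cats0 monomial_zeros /monomial !big_ord0 mulr1.
have [-> -> _] := mono_split j a r.
rewrite -code_variable !CodeSeq.codeK !monomial_step; congr (_ * _).
by rewrite monomial_zeros monomial_cons /monomial big_ord0 mulr1 addn0 expr0 mulr1.
Qed.

End MonomialTable.

(** Conversely the recursion determines the table from its values at the
    variables. *)
Lemma monomial_table_unique (z : nat -> Qi) (n : nat) : z 0%N = 1 ->
  (forall c, (c <= n)%N -> z c = z (mono_var c) * z (mono_rest c)) ->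
  forall l, (code l <= n)%N -> z (code l) = monomial (z \o var_code) l.
Proof.
move=> z0 zM l; have [k] := ubnP (code l); elim: k l => // k IHk l ltk len.
have [j [lE|[a [r lE]]]] := leading_zeros l.
  rewrite zM // lE; have [-> ->] := mono_split_zeros j; rewrite z0 mulr1.
  by rewrite -[nseq j 0%N]cats0 monomial_zeros /monomial big_ord0.
have [varE restE lt_rest] := mono_split j a r; rewrite lE in ltk len *.
rewrite zM // varE monomial_step; congr (_ * _); rewrite restE in lt_rest *.
by apply: IHk; lia.
Qed.

(** * Tables of polynomial values *)

Lemma Qi_int_neq0 (a : int) : a != 0 -> a%:~R != 0 :> Qi.
Proof.
by move=> a0; apply/eqP; rewrite -gauss_int => /gauss_eq0[aE _]; rewrite aE in a0.
Qed.

Lemma term_den0 : term_den 0 = 0.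
Proof. by rewrite /term_den !(code_tail0, code_head0) mul0r. Qed.

Lemma term_parts n (t : term n) :
  [/\ term_den (enc_term t) = (denq (complex.Re t.1))%:~R * (denq (complex.Im t.1))%:~R &
      term_num (enc_term t) = (numq (complex.Re t.1))%:~R * (denq (complex.Im t.1))%:~R
        + imag * ((numq (complex.Im t.1))%:~R * (denq (complex.Re t.1))%:~R)].
Proof.
rewrite /term_num /term_den /enc_term code_head_cons.
have -> : enc_Qi t.1 = code [:: enc_rat (complex.Re t.1); enc_rat (complex.Im t.1)] by [].
by rewrite !(code_tail_cons, code_head_cons) !enc_intK.
Qed.

Lemma term_den_enc n (t : term n) : term_den (enc_term t) != 0.
Proof. by have [-> _] := term_parts t; rewrite mulf_neq0 // Qi_int_neq0 ?denq_neq0. Qed.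

Lemma term_num_enc n (t : term n) :
  term_num (enc_term t) = t.1 * term_den (enc_term t).
Proof.
have [-> ->] := term_parts t; rewrite -!intrM -gaussE -gauss_int.
case: t.1 => x y /=; rewrite /gauss !intrM !numqE.
by congr Complex; ring.
Qed.

Lemma term_mono_enc n (t : term n) : term_mono (enc_term t) = code t.2.
Proof. by rewrite /term_mono /enc_term code_tail_cons code_head_cons. Qed.

Lemma meval_poly_of_terms n (s : seq (term n)) (v : 'I_n -> Qi) (w : nat -> Qi) :
  (forall i : 'I_n, w i = v i) ->
  (poly_of_terms s).@[v] = \sum_(t <- s) t.1 * monomial w t.2.
Proof.
move=> wE; rewrite /poly_of_terms raddf_sum /=; apply: eq_bigr => t _.
rewrite mevalZ mevalX; congr (_ * _).
rewrite /monomial size_tuple; apply: eq_bigr => i _; rewrite wE.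
by rewrite (mnm_nth 0).
Qed.

Section PolyTable.
Variable z : nat -> Qi.

Definition poly_table (s : nat) : Qi :=
  \sum_(r <- decode s) term_num r / term_den r * z (term_mono r).

Lemma poly_table0 : poly_table 0 = 0.
Proof. by rewrite /poly_table big_nil. Qed.

Lemma poly_tableE s :
  term_den (code_head s) *
  (term_den (code_head s) * (poly_table s - poly_table (code_tail s))
    - term_num (code_head s) * z (term_mono (code_head s))) = 0.
Proof.
rewrite -[s]CodeSeq.decodeK; case: (decode s) => [|r l].
  by rewrite [code_head _]code_head0 term_den0 mul0r.
rewrite code_head_cons code_tail_cons /poly_table !CodeSeq.codeK big_cons addrK.
have [->|d0] := eqVneq (term_den r) 0; first by rewrite mul0r.
by rewrite mulrA [_ * (_ / _)]mulrC mulfVK // subrr mulr0.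
Qed.

Lemma poly_table_enc n (s : seq (term n)) :
  poly_table (enc_seq (@enc_term n) s) = \sum_(t <- s) t.1 * z (code t.2).
Proof.
rewrite /poly_table CodeSeq.codeK big_map; apply: eq_bigr => t _.
by rewrite term_num_enc mulfK ?term_den_enc // term_mono_enc.
Qed.
End PolyTable.

(** On codes of actual terms the denominator is nonzero, so the recursion
    determines the partial sums. *)
Lemma poly_table_unique (z sg : nat -> Qi) (N : nat) : sg 0%N = 0 ->
  (forall s, (s <= N)%N -> term_den (code_head s) *
    (term_den (code_head s) * (sg s - sg (code_tail s))
     - term_num (code_head s) * z (term_mono (code_head s))) = 0) ->
  forall n (s : seq (term n)), (enc_seq (@enc_term n) s <= N)%N ->
    sg (enc_seq (@enc_term n) s) = \sum_(t <- s) t.1 * z (code t.2).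
Proof.
move=> sg0 sgE n; elim=> [|t s IHs] leN; first by rewrite big_nil.
have encE : enc_seq (@enc_term n) (t :: s)
  = code (enc_term t :: map (@enc_term n) s) by [].
have les : (enc_seq (@enc_term n) s <= N)%N.
  apply: leq_trans leN; have := code_tail_leq (enc_seq (@enc_term n) (t :: s)).
  by rewrite {1}encE code_tail_cons.
have := sgE _ leN; have -> : code_head (enc_seq (@enc_term n) (t :: s)) = enc_term t.
  by rewrite encE code_head_cons.
rewrite [code_tail _](code_tail_cons (enc_term t)) -/(enc_seq _ s).
rewrite term_mono_enc term_num_enc big_cons.
move: (term_den _) (term_den_enc t) => d d0.
rewrite [t.1 * d]mulrC -mulrA -mulrBr => /eqP.
by rewrite !mulf_eq0 !(negPf d0) /= subr_eq0 subr_eq IHs // => /eqP.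
Qed.

(** * A binary form with a zero over the 2-adic numbers but not over Q(i) *)

(** Hensel lifting of the even root of X^2 + X + 2.  Its derivative is odd, so
    if the quotient s is odd, then moving the root by 2^(k+1) makes it even. *)
Lemma dyadic_root k : exists r s : nat,
  (r.*2 ^ 2 + r.*2 + 2 = 2 ^ k.+1 * s)%N.
Proof.
elim: k => [|k [r [s rsE]]]; first by exists 0%N, 1%N.
have [evs|ods] := boolP (~~ odd s).
  by exists r, s./2; rewrite rsE [in RHS]expnSr -mulnA mul2n even_halfK.
rewrite negbK in ods.
exists (r + 2 ^ k)%N, ((s + r.*2.*2.+1)./2 + 2 ^ k)%N.
have even_s : ((s + r.*2.*2.+1)./2.*2 = s + r.*2.*2.+1)%N.
  by rewrite even_halfK // oddD ods /= odd_double.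
have -> : (2 ^ k.+2 * ((s + r.*2.*2.+1)./2 + 2 ^ k) =
    2 ^ k.+1 * ((s + r.*2.*2.+1)./2.*2 + 2 ^ k.+1))%N.
  by rewrite expnSr -mulnA mulnDr mul2n -expnS.
rewrite even_s mulnDr mulnDr -rsE (expnS 2 k) -!mul2n; ring.
Qed.

Lemma seven_nonsquare (a b : nat) : (a ^ 2 = 7 * b ^ 2)%N -> b = 0%N.
Proof.
case: (posnP b) => // b_gt0 abE; have a_gt0 : (0 < a)%N.
  by rewrite lt0n; apply: contra_eqN abE => /eqP->; rewrite eq_sym muln_eq0 expn_eq0; lia.
have := congr1 (logn 7) abE.
by rewrite lognM ?expn_gt0 ?b_gt0 // !lognX (pfactorK 1) //; lia.
Qed.

Lemma rat_sq_neq7 (x : rat) : x * x != 7%:R.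
Proof.
apply/eqP => xx.
have : (numq x * numq x = 7%:Z * (denq x * denq x)).
  apply: (@intr_inj rat); rewrite !intrM numqE.
  by transitivity (x * x * ((denq x)%:~R * (denq x)%:~R)); [ring | rewrite xx].
move/(congr1 absz); rewrite !abszM /= !mulnn => /seven_nonsquare/eqP.
by rewrite absz_eq0 denq_eq0.
Qed.

(** A root r = t / T of X^2 + X + 2 in Q(i) would give (2r + 1)^2 = -7. *)
Lemma two_adic_form_anisotropic (t T : Qi) :
  t * t + t * T + 2%:R * (T * T) = 0 -> T = 0.
Proof.
move=> tT0; apply/eqP; apply: contraT => T0.
pose z := 2%:R * (t / T) + 1.
have : z * z = gauss (-7) 0.
  have -> : z * z = 4%:R / (T * T) * (t * t + t * T + 2%:R * (T * T)) - 7%:R.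
    by rewrite /z; field.
  by rewrite tT0 mulr0 sub0r gauss_int mulrNz.
case: z => x y; rewrite /gauss => -[xxyy /eqP].
rewrite [y * x]mulrC -mulr2n mulrn_eq0 /= mulf_eq0 => /orP[] /eqP xy0.
  move/eqP: xxyy; rewrite xy0 mul0r sub0r mulrNz eqr_opp => yy.
  by have := rat_sq_neq7 y; rewrite yy.
by have := sqr_ge0 x; move: xxyy; rewrite xy0 mul0r subr0 expr2 => ->.
Qed.

(** * Equivalence of an instance with its quadratic system *)

Lemma common_denominator (f : nat -> Qi) n : exists2 D : nat, (0 < D)%N &
  forall i, (i < n)%N -> exists a b, D%:R * f i = gauss a b.
Proof.
elim: n => [|n [D D_gt0 DP]]; first by exists 1%N.
have natG k : k%:R = gauss k%:Z 0 :> Qi by rewrite gauss_int.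
case fnE: (f n) => [x y]; set d := (`|denq x| * `|denq y|)%N.
exists (D * d)%N; first by rewrite !muln_gt0 D_gt0 !absz_gt0 !denq_neq0.
move=> i; rewrite ltnS leq_eqVlt => /orP[/eqP->|ltin].
  exists (D%:Z * denq y * numq x), (D%:Z * denq x * numq y).
  rewrite fnE natG !PoszM !absz_denq /gauss !intrM !numqE.
  apply/eqP; rewrite eq_complex /=.
  by apply/andP; split; apply/eqP; ring.
have [a [b Dfi]] := DP i ltin; exists (d%:Z * a), (d%:Z * b).
rewrite natrM [D%:R * _]mulrC -mulrA Dfi natG -gaussM.
by rewrite !mul0r subr0 addr0.
Qed.

Section Reduction.
Variable x : HTP_input.
Let e := enc_HTP x.
Let m := system_size e.

Lemma system_codeE :
  code_head (code_tail e) = code (map (enc_seq (@enc_term _)) (HTP_system x)).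
Proof.
have -> : e = code [:: HTP_nvars x;
  code (map (enc_seq (@enc_term _)) (HTP_system x))] by [].
by rewrite code_tail_cons code_head_cons.
Qed.

Lemma poly_code_system l :
  poly_code e l = nth 0%N (map (enc_seq (@enc_term _)) (HTP_system x)) l.
Proof.
by rewrite /poly_code system_codeE code_nth_code.
Qed.

Lemma size_system_leq : (size (HTP_system x) <= e)%N.
Proof.
rewrite -(size_map (enc_seq (@enc_term _))).
apply: leq_trans (size_code_leq _) _.
rewrite -system_codeE.
exact: leq_trans (code_head_leq _) (code_tail_leq _).
Qed.

(** Division by Z turns the equations into the recursions that characterize the
    tables of monomials and of polynomial values. *)
Lemma system_sound (y : nat -> Qi) : y ix_T != 0 ->
  (forall k, (k < m)%N -> form_value e y (system_coef e k) = 0) ->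
  has_common_zero (HTP_polys x).
Proof.
move=> yT0 /system_forms_zero[eq0 eqs].
have Z0 : y (ix_mono 0) != 0.
  apply/eqP => yZ0; case/eqP: yT0.
  apply: (@two_adic_form_anisotropic (y ix_U)).
  apply/eqP; rewrite -oppr_eq0; apply/eqP; rewrite -[RHS]eq0 /scale_eqn yZ0; ring.
pose z c := y (ix_mono c) / y (ix_mono 0); pose sg s := y (ix_sum s) / y (ix_mono 0).
have z0 : z 0%N = 1 by rewrite /z divff.
have zM c : (c <= e)%N -> z c = z (mono_var c) * z (mono_rest c).
  case/eqs=> + _ _; rewrite /mono_eqn => /eqP; rewrite subr_eq0 => /eqP E.
  rewrite /z mulrACA -E; field; exact: Z0.
have sgP l : (l <= e)%N -> sg (poly_code e l) = 0.
  case/eqs=> _ _; rewrite /poly_eqn => /eqP; rewrite mulf_eq0 (negPf Z0) /= => /eqP E.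
  by rewrite /sg E mul0r.
(* Beyond the end of the system, the code 0 of the empty polynomial is read. *)
have sg0 : sg 0%N = 0.
  have := sgP _ size_system_leq; rewrite poly_code_system nth_default //.
  by rewrite size_map.
have sgE s : (s <= e)%N -> term_den (code_head s) *
    (term_den (code_head s) * (sg s - sg (code_tail s))
     - term_num (code_head s) * z (term_mono (code_head s))) = 0.
  case/eqs=> _ + _; rewrite /sum_eqn /sg /z.
  move: (term_den _) (term_num _) => d g E.
  apply: (mulfI (mulf_neq0 Z0 Z0)); rewrite mulr0 -[RHS]E; field; exact: Z0.
exists (fun i => z (var_code i)) => p /mapP[s sin ->].
rewrite (@meval_poly_of_terms _ s _ (z \o var_code)) //.
have [l ltl sE] : exists2 l, (l <= e)%N & enc_seq (@enc_term _) s = poly_code e l.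
  exists (index s (HTP_system x)).
    by apply: leq_trans size_system_leq; apply: index_size.
  by rewrite poly_code_system (nth_map [::]) ?index_mem // nth_index.
rewrite -[RHS](sgP l ltl) -sE (poly_table_unique (z := z) (N := e) sg0 sgE); last first.
  by rewrite sE poly_code_leq.
apply: eq_big_seq => t tin; congr (_ * _).
rewrite (monomial_table_unique (n := e) z0 zM) //.
rewrite -term_mono_enc; apply: leq_trans (term_mono_leq _) _.
apply: leq_trans (poly_code_leq e l); rewrite -sE /enc_seq ltnW //.
by apply: (allP (CodeSeq.ltn_code _)); apply: map_f.
Qed.

(** The tables of a common zero solve the equations for Z = 1; scaling by a common
    denominator gives a Gaussian solution, to which T, U and W are adjusted. *)
Lemma system_complete : has_common_zero (HTP_polys x) -> exists2 y : nat -> Qi,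
  forall p, (p < m)%N -> exists g h, y p = (p == 0%N)%:R + 2%:R * gauss g h &
  forall k, (k < m)%N -> form_value e y (system_coef e k) = 0.
Proof.
case=> v vP; pose w j := oapp v 0 (insub j).
pose z := monomial_table w; pose sg := poly_table z.
pose val p := if (p %% 3 == 0)%N then z (p %/ 3)%N.-1 else
  if (p %% 3 == 1)%N then sg (p %/ 3)%N.-1 else 0.
have valZ c : val (ix_mono c) = z c.
  rewrite /val /ix_mono; have -> : ((3 * c + 3) %% 3 = 0)%N by lia.
  by have -> : ((3 * c + 3) %/ 3)%N.-1 = c by lia.
have valS s : val (ix_sum s) = sg s.
  rewrite /val /ix_sum; have -> : ((3 * s + 4) %% 3 = 1)%N by lia.
  by have -> : ((3 * s + 4) %/ 3)%N.-1 = s by lia.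
(* The solution is scaled by Z = 2D = 2^(j+1) T with T odd.  The unknown U is T
   times an even root modulo 2^(j+2), which leaves an even value for W. *)
have [D D_gt0 DP] := common_denominator val m.
have [j [t DE]] : exists j t, D = (2 ^ j * t.*2.+1)%N.
  case: (codeP D) => [D0|->]; first by rewrite D0 in D_gt0.
  by exists (code_head D), (code_tail D).
have [r [s rsE]] := dyadic_root j.+1.
pose T : nat := t.*2.+1.
pose y p := if p is p'.+3 then 2%:R * (D%:R * val p) else
  if p is 0 then T%:R else if p is 1 then 2%:R * (T * s)%:R else (T * r.*2)%:R : Qi.
have yZ c : y (ix_mono c) = 2%:R * D%:R * z c.
  by rewrite -valZ -mulrA /ix_mono addn3.
have yS s' : y (ix_sum s') = 2%:R * D%:R * sg s'.
  by rewrite -valS -mulrA /ix_sum addnS addn3.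
exists y.
  have natG k : k%:R = gauss k%:Z 0 :> Qi by rewrite gauss_int.
  case=> [|[|[|p]]] ltp /=.
  - by exists t, 0; rewrite /T -natG -natrM -natrD mul2n.
  - by exists (T * s)%N, 0; rewrite -natG add0r.
  - by exists (T * r)%N, 0; rewrite -natG add0r -natrM -mul2n mulnCA.
  - by have [a [b ->]] := DP _ ltp; exists a, b; rewrite add0r.
apply/system_forms_zero; split.
  rewrite /scale_eqn yZ /z monomial_table0 mulr1 /=.
  have rsE' : (r.*2)%:R ^+ 2 + (r.*2)%:R + 2%:R = 2%:R ^+ j.+2 * s%:R :> Qi.
    by rewrite -!natrX -!natrD -natrM rsE.
  have -> : D%:R = 2%:R ^+ j * T%:R :> Qi by rewrite DE natrM natrX.
  rewrite !natrM.
  transitivity (T%:R ^+ 2 * (2%:R ^+ j.+2 * s%:R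
    - ((r.*2)%:R ^+ 2 + (r.*2)%:R + 2%:R)) : Qi); first by rewrite !exprS; ring.
  by rewrite rsE' subrr mulr0.
move=> c _; rewrite /mono_eqn /sum_eqn /poly_eqn !yZ !yS /z monomial_table0 mulr1.
split.
- by rewrite [in monomial_table w c]monomial_tableE; ring.
- rewrite -/z; have := poly_tableE z c; rewrite -/sg.
  move: (term_den _) (term_num _) => d g E.
  transitivity (2%:R * D%:R * (2%:R * D%:R) * 0 : Qi); last by rewrite mulr0.
  by rewrite -E; ring.
- rewrite poly_code_system; have [ltc|gec] := ltnP c (size (HTP_system x)); last first.
    by rewrite nth_default ?size_map // /sg poly_table0 !mulr0.
  rewrite (nth_map [::]) // /sg poly_table_enc; set P := nth _ _ c.
  have := vP (poly_of_terms P) (map_f _ (mem_nth _ ltc)).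
  rewrite (@meval_poly_of_terms _ P _ w) => [pw|i]; last by rewrite /w valK.
  rewrite (eq_bigr (fun t : term _ => t.1 * monomial w t.2)) ?pw ?mulr0 // => t' _.
  by rewrite /z /monomial_table CodeSeq.codeK.
Qed.
End Reduction.

(** * The theorem *)

Theorem theorem7 :
  HTP_Qi_undecidable -> Pi_undecidable (('X^2 + 1) ^+ 2).
Proof.
move=> HTP_undec [dec decP]; apply: HTP_undec.
have [c [[red redP] cE]] := structure_constants_computable.
exists (RComp dec [:: red]) => x; pose e := enc_HTP x.
have m_gt0 : (0 < system_size e)%N by rewrite /system_size addn3.
have [A encA zeroA] := quadratic_order m_gt0 (cE e).
have [b [decA bP]] := decP A; exists b; split.
  apply: (@reval_comp _ _ _ [:: enc_order A]) => //.
  by case=> // _; rewrite /= encA; apply: redP.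
rewrite bP zeroA; split=> [[y yP y0]|].
  apply: (system_sound (y := y)) => //.
  have [g [h ->]] := yP _ m_gt0; apply/eqP => yT0.
  have : gauss (1 + 2 * g) (2 * h) = 0.
    rewrite -[RHS]yT0 -[2%:R : Qi](gauss_int 2) -gaussM !mul0r subr0 addr0.
    by rewrite eqxx -[1%:R : Qi](gauss_int 1) -gaussD add0r.
  by case/gauss_eq0; lia.
case/(system_complete (x := x)) => y yP y0; exists y => //.
Qed.
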